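(* Let $\mathbf S=\{\mathbf S_{i,j}\}$ be the universal model associated with the noncommutative variety $\mathcal V^{\mathbf m}_{\mathbf f,J}$, where $J$ is a WOT-closed left ideal of the Hardy algebra $F^\infty(\mathbf D^{\mathbf m}_{\mathbf f})$. The joint eigenvectors for the operators $\mathbf S_{i,j}^*$ are, up to nonzero scalar multiples, precisely the noncommutative constrained Berezin kernels $$\Gamma_\lambda:=\Delta^{\mathbf m}_{\mathbf f,\lambda}(1)^{1/2}\sum_{\beta_i\in\mathbb F^+_{n_i},\,i=1,\dots,k}\overline{\lambda}_{1,\beta_1}\cdots\overline{\lambda}_{k,\beta_k}\sqrt{b^{(m_1)}_{1,\beta_1}}\cdots\sqrt{b^{(m_k)}_{k,\beta_k}}\;e^1_{\beta_1}\otimes\cdots\otimes e^k_{\beta_k}$$ for $\lambda=(\lambda_1,\dots,\lambda_k)\in\mathcal V^{\mathbf m}_{\mathbf f,J,>}(\mathbb C)$, where $\Delta^{\mathbf m}_{\mathbf f,\lambda}(1):=(1-\Phi_{f_1,\lambda_1}(1))^{m_1}\cdots(1-\Phi_{f_k,\lambda_k}(1))^{m_k}$. They satisfy the equations $$\mathbf S_{i,j}^*\Gamma_\lambda=\overline{\lambda}_{i,j}\Gamma_\lambda\qquad\text{for } i\in\{1,\dots,k\},\ j\in\{1,\dots,n_i\},$$ where $\lambda_i=(\lambda_{i,1},\dots,\lambda_{i,n_i})$.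
   Context: Fix $k\ge 1$ and $(n_1,\dots,n_k)$, $\mathbf m=(m_1,\dots,m_k)$ in $\mathbb N^k$, $\mathbb N=\{1,2,\dots\}$. $\mathbb F^+_{n_i}$ is the free unital semigroup on generators $g^i_1,\dots,g^i_{n_i}$ with identity $g^i_0$; $|\alpha|$ is word length. For a tuple $X_i=(X_{i,1},\dots,X_{i,n_i})$ (operators or scalars) and $\alpha=g^i_{j_1}\cdots g^i_{j_p}$ put $X_{i,\alpha}=X_{i,j_1}\cdots X_{i,j_p}$, $X_{i,g^i_0}=I$; for $\mathbf X=(X_1,\dots,X_k)$ and $(\alpha)=(\alpha_1,\dots,\alpha_k)$ put $\mathbf X_{(\alpha)}=X_{1,\alpha_1}\cdots X_{k,\alpha_k}$. $\mathbf f=(f_1,\dots,f_k)$, where each $f_i=\sum_{\alpha\in\mathbb F^+_{n_i}}a_{i,\alpha}Z_{i,\alpha}$ is a positive regular free holomorphic function: $a_{i,\alpha}\ge0$, $a_{i,g^i_0}=0$, $a_{i,g^i_j}>0$ for $1\le j\le n_i$, and $\limsup_{p\to\infty}(\sum_{|\alpha|=p}|a_{i,\alpha}|^2)^{1/2p}<\infty$. For $z_i\in\mathbb C^{n_i}$, $\Phi_{f_i,z_i}(1)=\sum_{|\alpha|\ge1}a_{i,\alpha}|z_{i,\alpha}|^2$. $F^2(H_{n_i})=\mathbb C1\oplus\bigoplus_{p\ge1}H_{n_i}^{\otimes p}$ is the full Fock space over an $n_i$-dimensional Hilbert space, with orthonormal basis $\{e^i_\alpha\}_{\alpha\in\mathbb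 F^+_{n_i}}$, $e^i_{g^i_0}=1$. Set $b^{(m_i)}_{i,g^i_0}=1$ and $b^{(m_i)}_{i,\alpha}=\sum_{p=1}^{|\alpha|}\sum_{\gamma_1\cdots\gamma_p=\alpha,\,|\gamma_s|\ge1}a_{i,\gamma_1}\cdots a_{i,\gamma_p}\binom{p+m_i-1}{m_i-1}$ for $|\alpha|\ge1$; $W_{i,j}e^i_\alpha=\sqrt{b^{(m_i)}_{i,\alpha}/b^{(m_i)}_{i,g^i_j\alpha}}\;e^i_{g^i_j\alpha}$; $\mathbf W_{i,j}=I\otimes\cdots\otimes W_{i,j}\otimes\cdots\otimes I$ ($i$-th factor) on $\otimes_{i=1}^kF^2(H_{n_i})$. $F^\infty(\mathbf D^{\mathbf m}_{\mathbf f})$ is the sequential SOT- (equivalently WOT-, $w^*$-) closure of the polynomials in the $\mathbf W_{i,j}$ and $I$; each $g$ in it has a unique Fourier representation $g=\sum_{(\beta)}c_{(\beta)}\mathbf W_{(\beta)}$. $\mathcal M_J$ is the closure of $J(\otimes_iF^2(H_{n_i}))$, $\mathcal N_J=[\otimes_iF^2(H_{n_i})]\ominus\mathcal M_J$, always assumed $\ne\{0\}$; $\mathbf S_{i,j}=P_{\mathcal N_J}\mathbf W_{i,j}|_{\mathcal N_J}$ on $\mathcal N_J$. A joint eigenvector for the $\mathbf S_{i,j}^*$ is a nonzero $h\in\mathcal N_J$ such that $\mathbf S_{i,j}^*h\in\mathbb Ch$ for all $i,j$. $\mathbf D^{\mathbf m}_{\mathbf f,>}(\mathbb C)=\{z=(z_1,\dots,z_k)\in\mathbb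 C^{n_1}\times\cdots\times\mathbb C^{n_k}:\ \sum_{|\alpha|\ge1}a_{i,\alpha}|z_{i,\alpha}|^2<1\text{ for each }i\}$. For $z$ in this set and $g=\sum c_{(\beta)}\mathbf W_{(\beta)}\in F^\infty(\mathbf D^{\mathbf m}_{\mathbf f})$, $g(z)=\sum_{(\beta)}c_{(\beta)}z_{(\beta)}$ (absolutely convergent). $\mathcal V^{\mathbf m}_{\mathbf f,J,>}(\mathbb C)=\{z\in\mathbf D^{\mathbf m}_{\mathbf f,>}(\mathbb C): g(z)=0\text{ for all }g\in J\}$. *)

(* Defs.v *)
From HB Require Import structures.
From mathcomp Require Import all_boot all_order all_algebra finmap.
From mathcomp Require Import complex.
From mathcomp Require Import all_classical all_reals all_analysis.
From mathcomp Require Import ring.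
From mathcomp Require Export summability.

Set Implicit Arguments.
Unset Strict Implicit.
Unset Printing Implicit Defensive.
Import Order.TTheory GRing.Theory Num.Theory numFieldNormedType.Exports.
Import Normc.

Local Open Scope classical_set_scope.
Local Open Scope ring_scope.
Local Open Scope complex_scope.

HB.instance Definition _ (R : realType) := NormedModule.copy R[i] R[i]^o.

Section SquareSum.
Context {R : realType} {I : choiceType}.
Implicit Types (x y : I -> R[i]) (c : R[i]).

(* The squared l^2 norm of the family x, in [0, +oo]. *)
Definition sqsum x : \bar R := (\esum_(i in [set: I]) (normc (x i) ^+ 2)%:E)%E.

Definition sqsummable : {pred I -> R[i]} := fun x => `[< (sqsum x < +oo)%E >].

Let normc_ge0 c : 0 <= normc c.
Proof. by case: c => a b; rewrite sqrtr_ge0. Qed.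

Let sqsum_ge0 x : (0 <= sqsum x)%E.
Proof. by apply: esum_ge0 => i _; rewrite lee_fin sqr_ge0. Qed.

Let le_esumZ (t : R) (f : I -> \bar R) : 0 <= t -> (forall i, (0 <= f i)%E) ->
  (\esum_(i in [set: I]) (t%:E * f i) <= t%:E * \esum_(i in [set: I]) f i)%E.
Proof.
move=> t0 f0; apply: ge_ereal_sup => _ [A [finA _]] <-.
rewrite -ge0_mule_fsumr// lee_wpmul2l ?lee_fin//.
by apply: ereal_sup_ubound; exists A.
Qed.

Let sqsumD (t : R) x y : 0 < t ->
  (sqsum (x + y)%R <= (1 + t)%:E * sqsum x + (1 + t^-1)%:E * sqsum y)%E.
Proof.
move=> t0; have t1 : 0 <= 1 + t by rewrite addr_ge0// ltW.
have t2 : 0 <= 1 + t^-1 by rewrite addr_ge0// invr_ge0 ltW.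
apply: (@le_trans _ _ (\esum_(i in [set: I])
   ((1 + t)%:E * (normc (x i) ^+ 2)%:E
    + (1 + t^-1)%:E * (normc (y i) ^+ 2)%:E))%E); last first.
  rewrite esumD; last 2 first.
  - by move=> i _; rewrite mule_ge0// lee_fin// sqr_ge0.
  - by move=> i _; rewrite mule_ge0// lee_fin// sqr_ge0.
  by apply: leeD; apply: le_esumZ => // i; rewrite lee_fin sqr_ge0.
apply: le_esum => i _; rewrite -!EFinM -EFinD lee_fin.
apply: (@le_trans _ _ ((normc (x i) + normc (y i)) ^+ 2)).
  rewrite ler_pXn2r ?nnegrE ?addr_ge0 ?normc_ge0//.
  exact: le_normcD.
move: (normc (x i)) (normc (y i)) => u v.
rewrite -subr_ge0.
have -> : (1 + t) * u ^+ 2 + (1 + t^-1) * v ^+ 2 - (u + v) ^+ 2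
    = t * (u - t^-1 * v) ^+ 2.
  by have tne0 : t != 0; [rewrite gt_eqF | field].
by rewrite mulr_ge0 ?sqr_ge0// ltW.
Qed.

Let sqsumZ_le c x : (sqsum (c *: x)%R <= (normc c ^+ 2)%:E * sqsum x)%E.
Proof.
apply: (@le_trans _ _ (\esum_(i in [set: I])
    ((normc c ^+ 2)%:E * (normc (x i) ^+ 2)%:E))%E); last first.
  by apply: le_esumZ => [|i]; rewrite ?lee_fin sqr_ge0.
by apply: le_esum => i _; rewrite -EFinM lee_fin normcM exprMn.
Qed.

Let sqsumZ c x : sqsum (c *: x)%R = ((normc c ^+ 2)%:E * sqsum x)%E.
Proof.
have [->|c0] := eqVneq c 0.
  by rewrite scale0r normc0 expr0n/= mul0e; apply: esum1 => i _;
     rewrite normc0 expr0n.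
apply/eqP; rewrite eq_le sqsumZ_le/=.
have nc0 : normc c != 0 by apply: contra c0 => /eqP/eq0_normc ->.
rewrite -{1}[x](scalerK c0).
apply: (le_trans (lee_wpmul2l _ (sqsumZ_le _ _))).
  by rewrite lee_fin sqr_ge0.
by rewrite muleA -EFinM normcV exprVn mulfV ?mul1e// sqrf_eq0.
Qed.

Lemma sqsummable_submod_closed : GRing.submod_closed sqsummable.
Proof.
split.
  by apply/asboolP; rewrite /sqsum esum1 ?ltry// => i _; rewrite normc0 expr0n.
move=> c x y /asboolP xoo /asboolP yoo; apply/asboolP.
apply: le_lt_trans (sqsumD _ _ ltr01) _.
rewrite sqsumZ lte_add_pinfty// lte_mul_pinfty// ?lee_fin ?addr_ge0 ?invr_ge0//.
by rewrite lte_mul_pinfty// lee_fin sqr_ge0.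
Qed.

HB.instance Definition _ :=
  GRing.isSubmodClosed.Build R[i] (I -> R[i]) sqsummable
    sqsummable_submod_closed.


Definition l2norm x : R := Num.sqrt (fine (sqsum x)).

Lemma l2norm_eq0 x : x \in sqsummable -> l2norm x = 0 -> x = 0.
Proof.
move=> /asboolP xoo /eqP; rewrite sqrtr_eq0 => x0; apply/funext => i.
have xfin : sqsum x \is a fin_num by rewrite ge0_fin_numE.
have xi : ((normc (x i) ^+ 2)%:E <= sqsum x)%E.
  apply: ereal_sup_ubound; exists [set i]; last by rewrite fsbig_set1.
  by split => //; exact: finite_set1.
have : normc (x i) ^+ 2 <= 0.
  by rewrite -lee_fin (le_trans xi)// -(fineK xfin) lee_fin.
rewrite le_eqVlt ltNge sqr_ge0 orbF sqrf_eq0 => /eqP; exact: eq0_normc.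
Qed.

Lemma l2normZ c x : l2norm (c *: x) = normc c * l2norm x.
Proof.
rewrite /l2norm sqsumZ; have : (0 <= sqsum x)%E by [].
have nc : 0 <= normc c ^+ 2 by rewrite sqr_ge0.
have nc1 : Num.sqrt (normc c ^+ 2) = normc c.
  by rewrite sqrtr_sqr ger0_norm.
case: (sqsum x) => [r|_|//]; first by rewrite /= lee_fin => r0; rewrite sqrtrM// nc1.
have [nc0|nc0] := eqVneq (normc c ^+ 2) 0; first by rewrite nc0 mul0e/= sqrtr0 mulr0.
by rewrite gt0_muley ?lte_fin ?lt_neqAle 1?eq_sym ?nc0//= sqrtr0 mulr0.
Qed.

Lemma ler_l2normD x y : x \in sqsummable -> y \in sqsummable ->
  l2norm (x + y) <= l2norm x + l2norm y.
Proof.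
move=> xS yS.
have [X0|X0] := eqVneq (l2norm x) 0.
  by rewrite X0 (l2norm_eq0 xS X0) !add0r.
have [Y0|Y0] := eqVneq (l2norm y) 0.
  by rewrite Y0 (l2norm_eq0 yS Y0) !addr0.
have fineS z : z \in sqsummable -> sqsum z = (l2norm z ^+ 2)%:E.
  move=> /asboolP zoo; rewrite sqr_sqrtr ?fine_ge0// fineK//.
  by rewrite ge0_fin_numE.
have Xp : 0 < l2norm x by rewrite lt_neqAle eq_sym X0 sqrtr_ge0.
have Yp : 0 < l2norm y by rewrite lt_neqAle eq_sym Y0 sqrtr_ge0.
have := @sqsumD (l2norm y / l2norm x) x y (divr_gt0 Yp Xp).
rewrite (fineS x xS) (fineS y yS) (fineS (x + y)); last first.
  by rewrite -[x]scale1r; apply: (sqsummable_submod_closed.2).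
rewrite -!EFinM -EFinD lee_fin => h.
rewrite -(@ler_pXn2r _ 2)// ?nnegrE ?addr_ge0 ?sqrtr_ge0//.
apply: (le_trans h); rewrite le_eqVlt; apply/orP; left; apply/eqP.
by field; rewrite X0 Y0.
Qed.
End SquareSum.

Record l2 (R : realType) (I : choiceType) :=
  L2 { l2val :> I -> R[i] ; _ : l2val \in sqsummable }.

Section L2.
Context {R : realType} {I : choiceType}.
Implicit Types (x y : l2 R I) (c : R[i]).
HB.instance Definition _ := [isSub for @l2val R I].
HB.instance Definition _ := [Choice of l2 R I by <:].
HB.instance Definition _ := [SubChoice_isSubLmodule of l2 R I by <:].

Let norm x : R[i] := (l2norm x)%:C.

Let normD x y : norm (x + y) <= norm x + norm y.
Proof.
by rewrite -rmorphD lecR; exact: (ler_l2normD (valP x) (valP y)).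
Qed.

Let normZ c x : norm (c *: x) = `|c| * norm x.
Proof.
by rewrite normc_def -rmorphM; congr _%:C; rewrite /= l2normZ; case: c.
Qed.

Let norm_eq0 x : norm x = 0 -> x = 0.
Proof.
by move=> /complexI x0; apply/val_inj; apply: (l2norm_eq0 (valP x)).
Qed.

HB.instance Definition _ :=
  Lmodule_isNormed.Build R[i] (l2 R I) normD normZ norm_eq0.

(* The family x as a vector of l^2(I), and 0 if it is not square summable. *)
Definition mkl2 (x : I -> R[i]) : l2 R I := insubd 0 x.

Definition onbasis (i : I) : l2 R I := mkl2 (fun j => (j == i)%:R).

(* [sum] is the limit of the net of finite partial sums. *)
Definition inner x y : R[i] := sum (fun i => x i * (y i)^*).

Definition bounded_operator (T : l2 R I -> l2 R I) : Prop :=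
  linear T /\ continuous T.

(* T is in the closure of A in the weak operator topology. *)
Definition wot_closure (A : set (l2 R I -> l2 R I)) (T : l2 R I -> l2 R I) :=
  forall (N : nat) (x y : 'I_N -> l2 R I) (eps : R), 0 < eps ->
    exists2 S, A S &
      forall l, `|inner (T (x l) - S (x l)) (y l)| < eps%:C.

Definition orthocomplement (M : set (l2 R I)) : set (l2 R I) :=
  [set h | forall v, M v -> inner h v = 0].

(* The orthogonal projection of x onto the closed subspace N. *)
Definition orthoproj (N : set (l2 R I)) x : l2 R I :=
  get [set p | N p /\ orthocomplement N (x - p)].

(* For an operator S on the Hilbert space N (a closed subspace), the value at
   h in N of the adjoint of S. *)
Definition adjoint_on (N : set (l2 R I)) (S : l2 R I -> l2 R I) h : l2 R I :=
  get [set v | N v /\ forall x, N x -> inner (S x) h = inner x v].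
End L2.

(* The free unital semigroup on n generators is [seq 'I_n], with product [cat],
   identity [[::]] and length [size]; a formal power series in n free variables
   is identified with its family of coefficients. *)

(* The full Fock space F^2(H_n), presented through its orthonormal basis
   e_w = [onbasis w]. *)
Notation fock1 R n := (l2 R (seq 'I_n)).

Section OneVariable.
Context {R : realType} {n : nat}.
Implicit Types (a : seq 'I_n -> R) (w : seq 'I_n).

Definition eval_word (z : 'rV[R[i]]_n) w : R[i] := \prod_(j <- w) z 0 j.

Definition positive_regular a : Prop :=
  [/\ forall w, 0 <= a w,
      a [::] = 0,
      forall j, 0 < a [:: j]
    & (limn_esup (fun p =>
         ((\sum_(w : p.-tuple 'I_n) `|a w| ^+ 2) `^ (2 * p%:R)^-1)%:E)
       < +oo)%E].

(* Phi_{f,z}(1), in [0, +oo]. *)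
Definition Phi a (z : 'rV[R[i]]_n) : \bar R :=
  (\esum_(w in [set w : seq 'I_n | (1 <= size w)%N])
     (a w * normc (eval_word z w) ^+ 2)%:E)%E.

Definition factorizations w (p : nat) : set (seq (seq 'I_n)) :=
  [set gs | [/\ size gs = p, flatten gs = w &
                forall g, g \in gs -> (1 <= size g)%N]].

Definition bcoef a (m : nat) w : R :=
  if w is [::] then 1 else
  \sum_(1 <= p < (size w).+1) \sum_(gs \in factorizations w p)
     (\prod_(g <- gs) a g) * 'C((p + m).-1, m.-1)%:R.

(* The weighted left creation operator
   e_w |-> sqrt (b_w / b_{g_j w}) e_{g_j w}; it is bounded when f is positive
   regular, as then b_{g_j w} >= a_{g_j} b_w. *)
Definition creation a (m : nat) (j : 'I_n) (x : fock1 R n) : fock1 R n :=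
  mkl2 (fun w => if w is j' :: w' then
                   if j' == j then
                     (Num.sqrt (bcoef a m w' / bcoef a m w))%:C * x w'
                   else 0
                 else 0).
End OneVariable.

Definition multiword (k : nat) (n : 'I_k -> nat) : Type :=
  {dffun forall i : 'I_k, seq 'I_(n i)}.

HB.instance Definition _ k (n : 'I_k -> nat) :=
  Choice.copy (multiword n) {dffun forall i : 'I_k, seq 'I_(n i)}.

(* The Hilbert tensor product of the spaces F^2(H_{n_i}); the vector
   e^1_{beta_1} (x) ... (x) e^k_{beta_k} is [onbasis beta]. *)
Notation fock R n := (l2 R (multiword n)).

Section Polydomain.
Context {R : realType} {k : nat} {n : 'I_k -> nat}.
Variables (a : forall i : 'I_k, seq 'I_(n i) -> R) (m : 'I_k -> nat).
Implicit Types (i : 'I_k) (beta : multiword n) (h x : fock R n).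
Implicit Types (T g : fock R n -> fock R n) (J : set (fock R n -> fock R n)).
Implicit Types (z : forall i, 'rV[R[i]]_(n i)).

Definition replace beta i (w : seq 'I_(n i)) : multiword n :=
  finfun (eqtype.dfwith beta w).

(* I (x) ... (x) T (x) ... (x) I with T in position i: the operator T acts on
   the i-th index, the other indices being frozen. *)
Definition ampliation i (T : fock1 R (n i) -> fock1 R (n i)) x :
    fock R n :=
  mkl2 (fun beta => T (mkl2 (fun w => x (replace beta w))) (beta i)).

Definition Wop i (j : 'I_(n i)) : fock R n -> fock R n :=
  ampliation (creation (@a i) (m i) j).

Definition Wword i (w : seq 'I_(n i)) : fock R n -> fock R n :=
  foldr (fun j T => Wop j \o T) idfun w.

Definition Wmultiword beta : fock R n -> fock R n :=
  foldr (fun i T => Wword (beta i) \o T) idfun (enum 'I_k).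

(* Finite linear combinations of products of the W_{i,j}; the empty product is
   the identity. *)
Definition W_polynomial T : Prop :=
  exists s : seq (R[i] * seq {i : 'I_k & 'I_(n i)}),
    T = fun x => \sum_(t <- s)
          t.1 *: foldr (fun ij S => Wop (tagged ij) \o S) idfun t.2 x.

(* The sequential SOT-closure of the polynomials. *)
Definition hardy_algebra : set (fock R n -> fock R n) :=
  [set T | bounded_operator T /\
     exists P : nat -> fock R n -> fock R n,
       (forall N, W_polynomial (P N)) /\
       (forall x, P N x @[N --> \oo] --> T x)].

Definition wot_closed_left_ideal J : Prop :=
  [/\ J `<=` hardy_algebra,
      J (fun=> 0),
      forall g1 g2, J g1 -> J g2 -> J (fun x => g1 x + g2 x),
      forall g1 g2, hardy_algebra g1 -> J g2 -> J (g1 \o g2)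
    & forall T, bounded_operator T -> wot_closure J T -> J T].

(* g = sum_beta c_beta W_beta, the series converging on the basis vectors. *)
Definition fourier_representation g (c : multiword n -> R[i]) : Prop :=
  forall alpha,
    partial_sum (fun beta => c beta *: Wmultiword beta (onbasis alpha)) A
      @[A --> totally] --> g (onbasis alpha).

Definition eval_multiword z beta : R[i] :=
  \prod_(i < k) eval_word (z i) (beta i).

Definition eval_hardy g z : R[i] :=
  let c := get (fourier_representation g) in
  sum (fun beta => c beta * eval_multiword z beta).

Definition scalar_polydomain z : Prop := forall i, (Phi (@a i) (z i) < 1)%E.

Definition scalar_variety J z : Prop :=
  scalar_polydomain z /\ forall g, J g -> eval_hardy g z = 0.

(* J(H) is not itself a linear set in general, J being only a left ideal; its
   linear span has the same orthogonal complement. *)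
Definition MJ J : set (fock R n) :=
  closure [set v | exists (N : nat) (g : 'I_N -> fock R n -> fock R n)
                     (x : 'I_N -> fock R n),
                     (forall l, J (g l)) /\ v = \sum_(l < N) g l (x l)].

Definition NJ J : set (fock R n) := orthocomplement (MJ J).

Definition Sop J i (j : 'I_(n i)) x : fock R n := orthoproj (NJ J) (Wop j x).

Definition Sadj J i (j : 'I_(n i)) : fock R n -> fock R n :=
  adjoint_on (NJ J) (Sop J j).

Definition joint_eigenvector J h : Prop :=
  [/\ NJ J h, h != 0 &
      forall i (j : 'I_(n i)), exists mu : R[i], Sadj J j h = mu *: h].

Definition Delta z : R := \prod_(i < k) (1 - fine (Phi (@a i) (z i))) ^+ m i.

Definition Gamma z : fock R n :=
  (Num.sqrt (Delta z))%:C *: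
    sum (fun beta =>
      ((\prod_(i < k) (eval_word (z i) (beta i))^*)
       * (\prod_(i < k) Num.sqrt (bcoef (@a i) (m i) (beta i)))%:C)
      *: onbasis beta).
End Polydomain.

(* Main.v *)
Require Import Defs.
From mathcomp Require Import all_boot all_order all_algebra finmap.
From mathcomp Require Import complex.
From mathcomp Require Import all_classical all_reals all_analysis.
From mathcomp Require Import ring lra zify.

(** The proof reduces everything to the coordinates of a vector in the
orthonormal basis indexed by multiwords [beta].

The adjoint of [W_{i,j}] reads coordinates one letter further: up to a positive
weight, its value at [h] has coordinate [h (g_j beta)] at [beta].  As [J] is a
left ideal, the span of the ranges of its elements is stable under every
[W_{i,j}], so [NJ J] is stable under the adjoints and the adjoint of [S_{i,j}]
is the restriction of that of [W_{i,j}] ([SadjE]; the projection theorem is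
what makes the compression [S_{i,j}] meaningful).  A joint eigenvector is
therefore a vector of [NJ J] that solves a one-letter recursion, which
determines it from its coordinate at the empty multiword: with eigenvalues
written as conjugates of [lambda_{i,j}], the vector [h] is a multiple of the
family [kernel_coef lambda] ([eigenvector_coef]).

Two conditions on [lambda] remain to be identified.

Square summability of [kernel_coef lambda] is the condition that [lambda] lies
in the scalar polydomain ([kernel_sqsummableP]).  The sum of the squares is a
product over [i] of sums of [b_w |lambda_w|^2]; writing [b] through the powers
of the power series [f_i], such a sum behaves as the binomial series of
[(1 - Phi) ^ - m].  It is finite if [Phi < 1] by comparison with that series,
and it forces [Phi < 1] because [b] dominates the convolution of [a] and [b],
so that a finite value [s] satisfies [1 + s * Phi <= s].

Orthogonality of the kernel [K] to the ranges of [J] is the vanishing of [J] at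
[lambda] ([NJ_kernel]).  Polynomials [p] in the shifts satisfy
[inner (p x) K = p(lambda) * inner x K], because [K] is an eigenvector of the
adjoints; by strong convergence every [g] in the Hardy algebra satisfies
[inner (g x) K = inner (g 1) K * inner x K] with [1] the vacuum vector.  The
scalar [inner (g 1) K] is the value [g(lambda)] computed from the Fourier
series: operators of the Hardy algebra intertwine the right translations of
multiwords up to weights, hence are determined by their value at the vacuum,
which gives existence and uniqueness of the Fourier coefficients
([hardy_fourier], [fourier_unique]). *)

Set Implicit Arguments.
Unset Strict Implicit.
Unset Printing Implicit Defensive.
Import Order.TTheory GRing.Theory Num.Theory numFieldNormedType.Exports.
Import Normc.
Local Open Scope classical_set_scope.
Local Open Scope complex_scope.
Local Open Scope ring_scope.

(** * Nets of finite sums *)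

Lemma partial_sumE (I : choiceType) (V : zmodType) (x : I -> V) (A : {fset I}) :
  partial_sum x A = \sum_(i <- A) x i.
Proof. by rewrite big_seq_fsetE. Qed.

#[local] Existing Instance totally_filter.

Section NetSums.
Context {R : realType}.

Lemma normC_normc (z : R[i]) : `|z| = (normc z)%:C.
Proof. by rewrite normc_def; case: z. Qed.

Lemma posC (e : R[i]) : 0 < e -> exists2 d : R, 0 < d & e = d%:C.
Proof. by case: e => x y; rewrite ltcE/= => /andP[/eqP -> x0]; exists x. Qed.

Lemma cvgCP (T : Type) (F : set_system T) (FF : Filter F) (f : T -> R[i]) z :
  f x @[x --> F] --> z <->
  forall e : R, 0 < e -> \forall x \near F, normc (z - f x) < e.
Proof.
split=> [/cvgrPdist_lt fz e e0|fz].
  have := fz e%:C; rewrite ltcR => /(_ e0); apply: filterS => x.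
  by rewrite normC_normc ltcR.
apply/cvgrPdist_lt => _ /posC[d d0 ->]; apply: filterS (fz d d0) => x.
by rewrite normC_normc ltcR.
Qed.

Lemma cvg_l2P (I : choiceType) (T : Type) (F : set_system T) (FF : Filter F)
    (f : T -> l2 R I) z :
  f x @[x --> F] --> z <->
  forall e : R, 0 < e -> \forall x \near F, l2norm (z - f x) < e.
Proof.
split=> [/cvgrPdist_lt fz e e0|fz].
  have := fz e%:C; rewrite ltcR => /(_ e0); apply: filterS => x.
  by rewrite ltcR.
apply/cvgrPdist_lt => _ /posC[d d0 ->]; apply: filterS (fz d d0) => x.
by rewrite ltcR.
Qed.

Lemma normcR (t : R) : normc t%:C = `|t|.
Proof. by rewrite /normc /= expr0n addr0 sqrtr_sqr. Qed.

Lemma net_cvgCP (I : choiceType) (f : I -> R[i]) (l : R[i]) :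
  (forall e : R, 0 < e -> exists A : {fset I}, forall B : {fset I},
     (A `<=` B)%fset -> normc (l - \sum_(i <- B) f i) < e) ->
  partial_sum f @ totally --> l.
Proof.
move=> fl; apply/(@cvgCP _ _ _ (partial_sum f)) => e /fl[A AP].
by exists A => // B /AP; rewrite partial_sumE.
Qed.

Lemma cvgC_real (T : Type) (F : set_system T) (FF : Filter F) (f : T -> R) (l : R) :
  f x @[x --> F] --> l -> (f x)%:C @[x --> F] --> l%:C.
Proof.
move=> /cvgrPdist_lt fl; apply/cvgCP => e e0; apply: filterS (fl e e0) => x.
by rewrite -rmorphB normcR.
Qed.

Lemma cvgCZ (T : Type) (F : set_system T) (FF : Filter F) c (f : T -> R[i]) l :
  f x @[x --> F] --> l -> c * f x @[x --> F] --> c * l.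
Proof. exact: (@cvgZl_tmp R[i] R[i] _ _ _ c f l). Qed.

Lemma fset_le_esum (I : choiceType) (f : I -> \bar R) (A : {fset I}) :
  (\sum_(i <- A) f i <= \esum_(i in [set: I]) f i)%E.
Proof.
apply: ereal_sup_ubound; exists [set` A]; first by split.
by rewrite fsbig_finite//= set_fsetK.
Qed.

Lemma esum_le_fset (I : choiceType) (f : I -> \bar R) (M : \bar R) :
  (forall A : {fset I}, (\sum_(i <- A) f i <= M)%E) ->
  (\esum_(i in [set: I]) f i <= M)%E.
Proof.
move=> fM; apply: ge_ereal_sup => _ [A [finA _] <-].
by rewrite fsbig_finite.
Qed.

Lemma nonneg_sum_cvg (I : choiceType) (f : I -> R) : (forall i, 0 <= f i) ->
  (\esum_(i in [set: I]) (f i)%:E < +oo)%E ->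
  partial_sum f @ totally --> fine (\esum_(i in [set: I]) (f i)%:E)%E.
Proof.
move=> f0 foo.
have S0 : (0 <= \esum_(i in [set: I]) (f i)%:E)%E.
  by apply: esum_ge0 => i _; rewrite lee_fin.
have Sfin : (\esum_(i in [set: I]) (f i)%:E)%E \is a fin_num.
  by rewrite ge0_fin_numE.
apply/cvgrPdist_lt => e e0.
have [_ [A [finA _] <-] Ae] := ub_ereal_sup_adherent e0 Sfin.
rewrite -/(esum _ _) fsbig_finite//= in Ae.
exists (fset_set A) => // B /= AB.
have leB := fset_le_esum (fun i => (f i)%:E) B.
move: Ae leB; rewrite -(fineK Sfin); set s := fine _.
rewrite !sumEFin -EFinB lte_fin lee_fin => Ae leB.
have AleB : \sum_(i <- fset_set A) f i <= \sum_(i <- B) f i.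
  rewrite (big_fsetID _ (fun i => i \in fset_set A) B)/=.
  rewrite -[leLHS]addr0 lerD ?sumr_ge0// le_eqVlt; apply/orP; left; apply/eqP.
  apply: eq_fbigl => i; rewrite !inE/=.
  by case: (boolP (i \in fset_set A)) => [/(fsubsetP AB) ->|]; rewrite ?andbF.
rewrite partial_sumE ger0_norm ?subr_ge0//.
rewrite ltrBlDr addrC -ltrBlDr; exact: lt_le_trans Ae AleB.
Qed.

(** Each of the real and imaginary parts [g] of [f] is the difference of the
nonnegative summable families [|f| + g] and [|f|], whose nets of finite sums are
monotone and bounded. *)
Lemma abs_sum_cvg (I : choiceType) (f : I -> R[i]) :
  (\esum_(i in [set: I]) (normc (f i))%:E < +oo)%E ->
  cvg (partial_sum f @ totally).
Proof.
move=> foo.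
have aRe i : `|complex.Re (f i)| <= normc (f i).
  by rewrite -lecR -normC_normc normc_ge_Re.
have aIm i : `|complex.Im (f i)| <= normc (f i).
  case: (f i) => x y /=; rewrite -sqrtr_sqr ler_sqrt ?addr_ge0 ?sqr_ge0//.
  by rewrite lerDr sqr_ge0.
have nc0 i : 0 <= normc (f i) by rewrite (le_trans _ (aRe i)).
have dom (g : I -> R) : (forall i, `|g i| <= normc (f i)) ->
    cvg (partial_sum (fun i => (g i)%:C) @ totally).
  move=> gf.
  pose p i := normc (f i) + g i.
  have p0 i : 0 <= p i.
    by have := gf i; rewrite ler_norml => /andP[]; rewrite /p; lra.
  have poo : (\esum_(i in [set: I]) (p i)%:E < +oo)%E.
    apply: (@le_lt_trans _ _
      (\esum_(i in [set: I]) ((normc (f i))%:E + (normc (f i))%:E))%E).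
      apply: le_esum => i _; rewrite -EFinD lee_fin /p lerD2l.
      exact: le_trans (ler_norm _) (gf i).
    by rewrite esumD ?lte_add_pinfty// => i _; rewrite lee_fin.
  have c1 := nonneg_sum_cvg p0 poo; have c2 := nonneg_sum_cvg nc0 foo.
  have -> : partial_sum (fun i => (g i)%:C) =
      (fun A => (partial_sum p A - partial_sum (fun i => normc (f i)) A)%:C).
    apply/funext => A; rewrite !partial_sumE -sumrB rmorph_sum.
    by apply: eq_bigr => i _; rewrite /p addrC addKr.
  by apply: cvgP; apply: cvgC_real; apply: cvgB; [exact: c1|exact: c2].
have [cR cI] := (dom _ aRe, dom _ aIm).
have -> : partial_sum f =
    partial_sum (fun i => (complex.Re (f i))%:C) +
    (fun A => 'i * partial_sum (fun i => (complex.Im (f i))%:C) A).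
  apply/funext => A; rewrite fctE !partial_sumE mulr_sumr -big_split/=.
  by apply: eq_bigr => i _; rewrite -complexE.
move: cR cI => /cvg_ex[l1 cR] /cvg_ex[l2 cI]; apply: (cvgP (l1 + 'i * l2)).
apply: cvgD; first exact: cR.
exact: cvgCZ.
Qed.

Lemma big_fset_preimage (I I' : choiceType) (V : zmodType) (s : I' -> I)
    (f : I -> V) (A : {fset I}) :
  injective s -> (forall i, (forall i', i <> s i') -> f i = 0) ->
  \sum_(i <- A) f i = \sum_(i' <- fset_set (s @^-1` [set` A])) f (s i').
Proof.
move=> sinj f0; set B := fset_set _.
have fins : finite_set (s @^-1` [set` A]).
  by apply: finite_preimage => // ? ? _ _; exact: sinj.
rewrite (big_fsetID _ (fun i => i \in (s @` B)%fset))/=.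
rewrite [X in _ + X]big1_fset ?addr0; last first.
  move=> i; rewrite !inE/= => /andP[iA iB] _; apply: f0 => i' ii'.
  case/negP: iB; rewrite ii'; apply/imfsetP; exists i' => //=.
  by rewrite in_fset_set// inE/= -ii'.
rewrite (_ : [fset x | x in A & x \in (s @` B)%fset]%fset = (s @` B)%fset).
  by rewrite big_imfset//= => ? ? _ _; exact: sinj.
apply/fsetP => i; rewrite !inE/=; have [iB|] := boolP (i \in (s @` B)%fset).
  case/imfsetP: iB => /= i'; rewrite in_fset_set// inE/= => + ->.
  by rewrite andbT.
by rewrite andbF.
Qed.

(** A net of finite sums keeps its limit when the indices at which the family
vanishes are removed: every finite set of remaining indices is the preimage of
a set that is as large as required. *)
Lemma sum_reindex (I I' : choiceType) (V : topologicalZmodType)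
    (s : I' -> I) (f : I -> V) (l : V) :
  injective s -> (forall i, (forall i', i <> s i') -> f i = 0) ->
  partial_sum f @ totally --> l -> partial_sum (f \o s) @ totally --> l.
Proof.
move=> sinj f0 fl U /fl [A _ AU].
have fins (C : {fset I}) : finite_set (s @^-1` [set` C]).
  by apply: finite_preimage => // ? ? _ _; exact: sinj.
exists (fset_set (s @^-1` [set` A])) => // B /= AB.
pose C := (s @` B `|` A)%fset.
have -> : partial_sum (f \o s) B = partial_sum f C.
  rewrite !partial_sumE (big_fset_preimage C sinj f0); congr (\sum_(i <- enum_fset _) _).
  apply/fsetP => i; apply/idP/idP; rewrite in_fset_set// inE/= in_fsetU mem_imfset//=.
    by move=> ->.
  by case/orP => // siA; apply: (fsubsetP AB); rewrite in_fset_set// inE.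
by apply: AU; rewrite /= fsubsetUr.
Qed.

End NetSums.

(** * The inner product of a square summable sequence space *)

Section Conjugation.
Context {R : realType}.
Implicit Types z w : R[i].

Lemma conjD z w : (z + w)^* = z^* + w^*.
Proof. exact: (rmorphD Num.conj). Qed.

Lemma conjN z : (- z)^* = - z^*.
Proof. exact: (rmorphN Num.conj). Qed.

Lemma conjB z w : (z - w)^* = z^* - w^*.
Proof. by rewrite conjD conjN. Qed.

Lemma conjM z w : (z * w)^* = z^* * w^*.
Proof. exact: (rmorphM Num.conj). Qed.

Lemma conj0 : (0 : R[i])^* = 0.
Proof. exact: (rmorph0 Num.conj). Qed.

Lemma conj1 : (1 : R[i])^* = 1.
Proof. exact: (rmorph1 Num.conj). Qed.

Lemma conjR (t : R) : (t%:C)^* = t%:C.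
Proof. exact: conjc_real. Qed.

Lemma conj_sum (T : Type) (s : seq T) (F : T -> R[i]) :
  (\sum_(t <- s) F t)^* = \sum_(t <- s) (F t)^*.
Proof. exact: (rmorph_sum Num.conj). Qed.

Lemma conj_prod (T : Type) (s : seq T) (F : T -> R[i]) :
  (\prod_(t <- s) F t)^* = \prod_(t <- s) (F t)^*.
Proof. exact: (rmorph_prod Num.conj). Qed.

Lemma realC_sum (T : Type) (s : seq T) (F : T -> R) :
  (\sum_(t <- s) F t)%:C = \sum_(t <- s) (F t)%:C.
Proof. exact: (rmorph_sum (real_complex R)). Qed.
End Conjugation.

Section HilbertSpace.
Context {R : realType} {I : choiceType}.
Implicit Types (x y v : l2 R I) (c : R[i]).

Lemma normc_sqr (z : R[i]) : ((normc z) ^+ 2)%:C = z * z^*.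
Proof. by rewrite -normCK normC_normc rmorphXn. Qed.

Lemma normc_ge0 (z : R[i]) : 0 <= normc z.
Proof. by case: z => u v; rewrite sqrtr_ge0. Qed.

Lemma normcJ_eq (z : R[i]) : normc z^* = normc z.
Proof. by apply: complexI; rewrite -!normC_normc norm_conjC. Qed.

Lemma mkl2E (f : I -> R[i]) : f \in sqsummable -> mkl2 f = f :> (I -> R[i]).
Proof. by move=> fS; rewrite /mkl2 insubdK. Qed.

Lemma l2P x y : (forall i, x i = y i) -> x = y.
Proof. by move=> xy; apply/val_inj/funext. Qed.

Lemma l2_scale_add c x y i : (c *: x + y) i = c * x i + y i.
Proof. by []. Qed.

Lemma l2_sum (T : Type) (s : seq T) (F : T -> l2 R I) i :
  (\sum_(t <- s) F t) i = \sum_(t <- s) F t i.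
Proof. by elim/big_rec2 : _ => //= t y z _ <-. Qed.

Lemma l2_sqsum x : sqsum x = (l2norm x ^+ 2)%:E.
Proof.
have /asboolP xoo := valP x.
have x0 : (0 <= sqsum x)%E by apply: esum_ge0 => i _; rewrite lee_fin sqr_ge0.
by rewrite sqr_sqrtr ?fine_ge0// fineK// ge0_fin_numE.
Qed.

Lemma l2norm_ge0 x : 0 <= l2norm x. Proof. by rewrite sqrtr_ge0. Qed.

Lemma sqsum_fset x (A : {fset I}) :
  \sum_(i <- A) normc (x i) ^+ 2 <= l2norm x ^+ 2.
Proof. by rewrite -lee_fin -sumEFin -l2_sqsum fset_le_esum. Qed.

Lemma normc_le_l2norm x i : normc (x i) <= l2norm x.
Proof.
rewrite -(@ler_pXn2r _ 2)// ?nnegrE ?normc_ge0 ?l2norm_ge0//.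
by have := sqsum_fset x [fset i]%fset; rewrite big_seq_fset1.
Qed.

Lemma sqsum_ltP (f : I -> R[i]) (M : R) :
  (forall A : {fset I}, \sum_(i <- A) normc (f i) ^+ 2 <= M) ->
  (sqsum f <= M%:E)%E.
Proof. by move=> fM; apply: esum_le_fset => A; rewrite sumEFin lee_fin. Qed.

Lemma sqsummable_fset (f : I -> R[i]) (M : R) :
  (forall A : {fset I}, \sum_(i <- A) normc (f i) ^+ 2 <= M) ->
  f \in sqsummable.
Proof.
by move=> /sqsum_ltP fM; apply/asboolP; apply: le_lt_trans fM _; rewrite ltry.
Qed.

Lemma l2norm_le (x : l2 R I) (M : R) : 0 <= M ->
  (forall A : {fset I}, \sum_(i <- A) normc (x i) ^+ 2 <= M ^+ 2) ->
  l2norm x <= M.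
Proof.
move=> M0 /sqsum_ltP; rewrite l2_sqsum lee_fin.
by rewrite ler_pXn2r// ?nnegrE ?l2norm_ge0.
Qed.

Lemma onbasisE (i j : I) : onbasis i j = (j == i)%:R :> R[i].
Proof.
rewrite /onbasis mkl2E//; apply/(sqsummable_fset (M := 1)) => A.
have [iA|iA] := boolP (i \in A).
  rewrite (big_fsetD1 i)//= eqxx normc1 expr1n big1_fset ?addr0// => j'.
  by rewrite !inE => /andP[/negPf -> _] _; rewrite normc0 expr0n.
rewrite big1_fset// => j' j'A _.
have [j'i|] := eqVneq j' i; first by rewrite -j'i j'A in iA.
by rewrite normc0 expr0n.
Qed.

Lemma inner_summable x y :
  (\esum_(i in [set: I]) (normc (x i * (y i)^*))%:E < +oo)%E.
Proof.
apply: (@le_lt_trans _ _ (\esum_(i in [set: I])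
    ((normc (x i) ^+ 2)%:E + (normc (y i) ^+ 2)%:E))%E).
  apply: le_esum => i _; rewrite -EFinD lee_fin normcM normcJ_eq.
  by have := normc_ge0 (x i); have := normc_ge0 (y i); nra.
rewrite esumD; try by move=> i _; rewrite lee_fin sqr_ge0.
by rewrite -!/(sqsum _) !l2_sqsum -EFinD ltry.
Qed.

Lemma inner_cvg x y :
  partial_sum (fun i => x i * (y i)^*) @ totally --> inner x y.
Proof. exact: abs_sum_cvg (inner_summable x y). Qed.

Arguments inner_cvg x y : clear implicits.

Lemma sumP (f : I -> R[i]) l : partial_sum f @ totally --> l -> sum f = l.
Proof. by move=> fl; apply: cvg_lim => //; exact: norm_hausdorff. Qed.

Lemma inner_eq x y l :
  partial_sum (fun i => x i * (y i)^*) @ totally --> l -> inner x y = l.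
Proof. exact: sumP. Qed.

Lemma innerDl x x' y : inner (x + x') y = inner x y + inner x' y.
Proof.
apply: inner_eq.
rewrite (_ : partial_sum _ = partial_sum (fun i => x i * (y i)^*) +
                             partial_sum (fun i => x' i * (y i)^*)).
  by apply: cvgD; exact: inner_cvg.
apply/funext => A; rewrite fctE !partial_sumE -big_split/=.
by apply: eq_bigr => i _; rewrite mulrDl.
Qed.

Lemma innerZl c x y : inner (c *: x) y = c * inner x y.
Proof.
apply: inner_eq.
rewrite (_ : partial_sum _ = fun A => c * partial_sum (fun i => x i * (y i)^*) A).
  by apply: cvgCZ; exact: inner_cvg.
apply/funext => A; rewrite !partial_sumE mulr_sumr.
by apply: eq_bigr => i _; rewrite mulrA.
Qed.

Lemma innerC x y : inner y x = (inner x y)^*.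
Proof.
apply: inner_eq.
rewrite (_ : partial_sum _ = fun A => (partial_sum (fun i => x i * (y i)^*) A)^*).
  have /cvgCP xy := inner_cvg x y; apply/cvgCP => e /xy; apply: filterS => A.
  by rewrite -conjB normcJ_eq.
apply/funext => A; rewrite !partial_sumE conj_sum.
by apply: eq_bigr => i _; rewrite conjM conjCK mulrC.
Qed.

Lemma innerDr x y y' : inner x (y + y') = inner x y + inner x y'.
Proof. by rewrite innerC innerDl conjD -!innerC. Qed.

Lemma innerZr c x y : inner x (c *: y) = c^* * inner x y.
Proof. by rewrite innerC innerZl conjM -innerC. Qed.

Lemma innerNl x y : inner (- x) y = - inner x y.
Proof. by rewrite -scaleN1r innerZl mulN1r. Qed.

Lemma innerBl x x' y : inner (x - x') y = inner x y - inner x' y.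
Proof. by rewrite innerDl innerNl. Qed.

Lemma innerBr x y y' : inner x (y - y') = inner x y - inner x y'.
Proof. by rewrite innerC innerBl conjB -!innerC. Qed.

Lemma inner0l y : inner 0 y = 0.
Proof. by rewrite -(scale0r 0) innerZl mul0r. Qed.

Lemma inner0r x : inner x 0 = 0.
Proof. by rewrite innerC inner0l conj0. Qed.

Lemma inner_suml (T : Type) (s : seq T) (F : T -> l2 R I) y :
  inner (\sum_(t <- s) F t) y = \sum_(t <- s) inner (F t) y.
Proof.
by elim/big_rec2 : _ => [|t z w _ <-]; rewrite ?inner0l ?innerDl.
Qed.

Lemma inner_xx x : inner x x = (l2norm x ^+ 2)%:C.
Proof.
apply: inner_eq.
have x0 i : 0 <= normc (x i) ^+ 2 by rewrite sqr_ge0.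
have := @nonneg_sum_cvg _ _ _ x0; rewrite -/(sqsum x) l2_sqsum ltry/=.
move=> /(_ isT) /cvgC_real.
rewrite (_ : (fun A => (partial_sum (fun i => normc (x i) ^+ 2) A)%:C) =
  partial_sum (fun i => x i * (x i)^*))//.
apply/funext => A; rewrite !partial_sumE realC_sum.
by apply: eq_bigr => i _; rewrite -normc_sqr.
Qed.

Lemma sum_single (f : I -> R[i]) i : (forall j, j != i -> f j = 0) ->
  partial_sum f @ totally --> f i.
Proof.
move=> f0; apply: net_cvgCP => e e0; exists [fset i]%fset => A iA.
rewrite (big_fsetD1 i)/=; last by rewrite (fsubsetP iA)// inE.
rewrite big1_fset ?addr0 ?subrr ?normc0// => j.
by rewrite !inE => /andP[/f0].
Qed.

Lemma inner_onbasis x i : inner x (onbasis i) = x i.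
Proof.
apply: inner_eq.
have := @sum_single (fun j => x j * (onbasis i j)^*) i.
rewrite onbasisE eqxx conj1 mulr1; apply => j /negPf ji.
by rewrite onbasisE ji conj0 mulr0.
Qed.

(** The direction [inner x v *: v] makes the squared norm a real quadratic
polynomial in [s]: its minimum gives the Cauchy-Schwarz inequality, and its
linear coefficient detects orthogonality at a nearest point. *)
Lemma l2norm_shift x v (s : R) :
  l2norm (x - (s%:C * inner x v) *: v) ^+ 2 =
  l2norm x ^+ 2 - 2 * s * normc (inner x v) ^+ 2
  + s ^+ 2 * normc (inner x v) ^+ 2 * l2norm v ^+ 2.
Proof.
have := normc_sqr (inner x v); have := inner_xx x; have := inner_xx v.
move: (_ ^+ 2) (_ ^+ 2) (normc _ ^+ 2) => V X c vE xE cE.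
apply: complexI; rewrite -inner_xx innerBl !innerBr !innerZl !innerZr.
rewrite (innerC x v) conjM conjR xE vE.
rewrite rmorphD rmorphB !rmorphM/= rmorph_nat cE.
ring.
Qed.

(** The minimum of the polynomial of [l2norm_shift] is nonnegative. *)
Lemma cauchy_schwarz x y : normc (inner x y) <= l2norm x * l2norm y.
Proof.
have [y0|y0] := eqVneq (l2norm y) 0.
  have -> : y = 0 by apply/val_inj; apply: l2norm_eq0 y0; exact: valP.
  by rewrite inner0r normc0 mulr_ge0 ?l2norm_ge0.
have := sqr_ge0 (l2norm (x - (((l2norm y ^+ 2)^-1)%:C * inner x y) *: y)).
rewrite l2norm_shift; set c := normc _; set N := l2norm y.
have N0 : 0 < N ^+ 2 by rewrite exprn_gt0// lt_def y0 l2norm_ge0.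
have -> : (N ^+ 2)^-1 ^+ 2 * c ^+ 2 * N ^+ 2 = (N ^+ 2)^-1 * c ^+ 2.
  by field.
move=> h; rewrite -(@ler_pXn2r _ 2)// ?nnegrE ?mulr_ge0 ?normc_ge0 ?l2norm_ge0//.
rewrite exprMn -ler_pdivrMr// mulrC.
lra.
Qed.

Lemma parallelogram x y :
  l2norm (x + y) ^+ 2 + l2norm (x - y) ^+ 2 =
  2 * l2norm x ^+ 2 + 2 * l2norm y ^+ 2.
Proof.
have := inner_xx x; have := inner_xx y.
have := inner_xx (x + y); have := inner_xx (x - y).
rewrite !(innerBl, innerBr, innerDl, innerDr).
move: (_ ^+ 2) (_ ^+ 2) (_ ^+ 2) (_ ^+ 2) => s d Y X sE dE YE XE.
apply: complexI; rewrite !rmorphD !rmorphM/= !rmorph_nat -sE -dE -YE -XE.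
ring.
Qed.

Lemma l2normN x : l2norm (- x) = l2norm x.
Proof. by rewrite -scaleN1r l2normZ normcN normc1 mul1r. Qed.

Lemma l2norm_scale c x : l2norm (c *: x) = normc c * l2norm x.
Proof. exact: l2normZ. Qed.

Lemma l2norm_triangle x y : l2norm (x + y) <= l2norm x + l2norm y.
Proof. exact: (ler_l2normD (valP x) (valP y)). Qed.

Lemma inner_cvgl (T : Type) (F : set_system T) (FF : Filter F) (f : T -> l2 R I) x y :
  f t @[t --> F] --> x -> inner (f t) y @[t --> F] --> inner x y.
Proof.
move=> /cvg_l2P fx; apply/cvgCP => e e0.
have y0 : 0 < l2norm y + 1 by rewrite ltr_wpDl ?l2norm_ge0.
apply: filterS (fx _ (divr_gt0 e0 y0)) => t xt.
rewrite -innerBl; apply: le_lt_trans (cauchy_schwarz _ _) _.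
rewrite ltr_pdivlMr// in xt; apply: le_lt_trans xt.
by rewrite ler_wpM2l ?l2norm_ge0// lerDl.
Qed.

Lemma coord_cvg (T : Type) (F : set_system T) (FF : Filter F) (f : T -> l2 R I) x i :
  f t @[t --> F] --> x -> f t i @[t --> F] --> x i.
Proof.
move=> fx; rewrite -inner_onbasis; under eq_cvg do rewrite -inner_onbasis.
exact: inner_cvgl.
Qed.

(** The partial sum [p] over [A] is the orthogonal projection of [x], so the
squared distance is the tail of the sum of squares. *)
Lemma onbasis_expansion x :
  partial_sum (fun i => x i *: onbasis i) @ totally --> x.
Proof.
have x0 i : 0 <= normc (x i) ^+ 2 by rewrite sqr_ge0.
have := @nonneg_sum_cvg _ _ _ x0; rewrite -/(sqsum x) l2_sqsum ltry/=.
move=> /(_ isT) /cvgrPdist_lt xA.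
apply/(@cvg_l2P _ _ _ _ _ (partial_sum (fun i => x i *: onbasis i))) => e e0.
apply: filterS (xA _ (exprn_gt0 2 e0)) => A.
rewrite ger0_norm; last by rewrite subr_ge0 partial_sumE sqsum_fset.
move=> Ae; rewrite -(@ltr_pXn2r _ 2)// ?nnegrE ?l2norm_ge0 ?(ltW e0)//.
apply: le_lt_trans Ae; set p := partial_sum (fun i => x i *: onbasis i) A.
have -> : l2norm (x - p) ^+ 2 =
    l2norm x ^+ 2 - partial_sum (fun i => normc (x i) ^+ 2) A; last by [].
have pE y : inner p y = \sum_(i <- A) x i * (y i)^*.
  rewrite /p partial_sumE inner_suml; apply: eq_bigr => i _.
  by rewrite innerZl innerC inner_onbasis.
have pA i : i \in A -> p i = x i.
  move=> iA; rewrite -inner_onbasis pE (big_fsetD1 i)//= onbasisE eqxx conj1 mulr1.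
  rewrite big1_fset ?addr0// => j; rewrite !inE onbasisE => /andP[ji _] _.
  by rewrite (negPf ji) conj0 mulr0.
have := inner_xx (x - p); have := inner_xx x.
have nA : inner p x = (partial_sum (fun i => normc (x i) ^+ 2) A)%:C.
  rewrite pE partial_sumE realC_sum; apply: eq_bigr => i _.
  by rewrite normc_sqr.
have pp : inner p p = inner p x.
  by rewrite !pE big_seq [RHS]big_seq; apply: eq_bigr => i /pA ->.
rewrite innerBl !innerBr pp subrr subr0 (innerC p x) nA conjR => -> /esym.
by rewrite -rmorphB => /complexI ->.
Qed.

End HilbertSpace.

Arguments inner_cvg {R I} x y.

(** * Orthogonal projection onto a closed subspace *)

Section Projection.
Context {R : realType} {I : choiceType}.
Implicit Types (x y v : l2 R I).

(** Coordinatewise limits suffice for completeness: a finite partial sum of the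
squared norm of [u n - p] is a limit of partial sums bounded by [e n ^+ 2]. *)
Lemma l2_complete (u : nat -> l2 R I) (e : nat -> R) :
  (forall n m, (n <= m)%N -> l2norm (u n - u m) <= e n) ->
  e @ \oo --> (0 : R) ->
  exists p : l2 R I, forall n, l2norm (u n - p) <= e n.
Proof.
move=> ue e0.
have e_ge0 n : 0 <= e n by apply: le_trans (ue n n (leqnn n)); exact: l2norm_ge0.
have ccvg (r : nat -> R) :
    (forall n m, (n <= m)%N -> `|r n - r m| <= e n) -> cvg (r @ \oo).
  move=> re; apply/cauchy_cvgP/cauchy_exP => eps eps0.
  have /cvgrPdist_lt/(_ _ eps0)[N _ eN] := e0.
  exists (r N), N => // n /= Nn; rewrite /ball/=.
  apply: le_lt_trans (re _ _ Nn) _; have := eN N (leqnn N).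
  by rewrite /= sub0r normrN ger0_norm.
have sub1 n m i : (n <= m)%N -> normc (u n i - u m i) <= e n.
  by move=> nm; apply: le_trans (ue _ _ nm); exact: (normc_le_l2norm (u n - u m)).
have cRe i : cvg ((fun n => complex.Re (u n i)) @ \oo).
  apply: ccvg => n m nm; apply: le_trans (sub1 _ _ i nm).
  case: (u n i) (u m i) => a b [c d] /=; rewrite -sqrtr_sqr ler_sqrt.
    by rewrite lerDl sqr_ge0.
  by rewrite addr_ge0 ?sqr_ge0.
have cIm i : cvg ((fun n => complex.Im (u n i)) @ \oo).
  apply: ccvg => n m nm; apply: le_trans (sub1 _ _ i nm).
  case: (u n i) (u m i) => a b [c d] /=; rewrite -sqrtr_sqr ler_sqrt.
    by rewrite lerDr sqr_ge0.
  by rewrite addr_ge0 ?sqr_ge0.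
pose p i : R[i] := lim ((fun n => complex.Re (u n i)) @ \oo)
  +i* lim ((fun n => complex.Im (u n i)) @ \oo).
have nsq (z : R[i]) : normc z ^+ 2 = complex.Re z ^+ 2 + complex.Im z ^+ 2.
  by case: z => a b /=; rewrite sqr_sqrtr// addr_ge0 ?sqr_ge0.
have pA n (A : {fset I}) : \sum_(i <- A) normc (u n i - p i) ^+ 2 <= e n ^+ 2.
  have cU : (fun m => \sum_(i <- A) normc (u n i - u m i) ^+ 2) @ \oo -->
      \sum_(i <- A) normc (u n i - p i) ^+ 2.
    apply: cvg_big => [|i _]; first exact: add_continuous.
    have {}nsq (q : R[i]) : normc (u n i - q) ^+ 2 =
        (complex.Re (u n i) - complex.Re q) ^+ 2
        + (complex.Im (u n i) - complex.Im q) ^+ 2.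
      by rewrite nsq; case: (u n i) q => a b [c d].
    rewrite nsq; under eq_cvg do rewrite nsq.
    have cB (r : nat -> R) (t : R) : cvg (r @ \oo) ->
        (t - r m) ^+ 2 @[m --> \oo] --> (t - lim (r @ \oo)) ^+ 2.
      move=> cr; rewrite !expr2; under eq_cvg do rewrite expr2.
      by apply: cvgM; apply: cvgB => //; exact: cvg_cst.
    by apply: cvgD; apply: cB.
  apply: (cvgr_to_le cU); exists n => // m /= nm.
  apply: le_trans (sqsum_fset (u n - u m) A) _.
  by rewrite ler_pXn2r ?nnegrE ?l2norm_ge0// ue.
have pS : p \in sqsummable.
  pose u0 : I -> R[i] := u 0%N.
  have -> : p = u0 - (u0 - p) by rewrite subKr.
  rewrite rpredB//; first exact: valP.
  exact: (@sqsummable_fset _ _ _ (e 0%N ^+ 2) (pA 0%N)).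
exists (mkl2 p) => n; apply: l2norm_le => // A.
have -> : \sum_(i <- A) normc ((u n - mkl2 p) i) ^+ 2 =
    \sum_(i <- A) normc (u n i - p i) ^+ 2; last exact: pA.
by apply: eq_bigr => i _; rewrite -[(u n - _) i]/(u n i - mkl2 p i) mkl2E.
Qed.

Variable N : set (l2 R I).
Hypothesis N0 : N 0.
Hypothesis Nlin : forall (c : R[i]) x y, N x -> N y -> N (c *: x + y).
Hypothesis Nclosed : forall (u : nat -> l2 R I) p,
  (forall n, N (u n)) -> u @ \oo --> p -> N p.

(** In a closed subspace, a minimizing sequence for the distance to [x] is
Cauchy by the parallelogram law. *)
Lemma nearest_point x : exists2 p, N p &
  forall y, N y -> l2norm (x - p) <= l2norm (x - y).
Proof.
pose D : set R := [set l2norm (x - y) ^+ 2 | y in N].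
have D0 : D !=set0 by exists (l2norm (x - 0) ^+ 2), 0.
have Dlb : lbound D 0 by move=> _ [y _ <-]; rewrite sqr_ge0.
have Dinf : has_inf D by split => //; exists 0.
pose d := inf D.
have dD y : N y -> d <= l2norm (x - y) ^+ 2.
  by move=> Ny; apply: inf_lbound; [case: Dinf|exists y].
have exu (n : nat) : exists y, N y /\ l2norm (x - y) ^+ 2 < d + harmonic n.
  have [_ [y Ny <-] yd] := inf_adherent (harmonic_gt0 n : 0 < harmonic n :> R) Dinf.
  by exists y.
pose u n := projT1 (cid (exu n)).
have uN n : N (u n) by rewrite /u; case: cid => ? [].
have ud n : l2norm (x - u n) ^+ 2 < d + harmonic n by rewrite /u; case: cid => ? [].
(* The parallelogram law at the midpoint of [u n] and [u m] bounds their squared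
   distance by [4 * harmonic n]. *)
pose e n : R := 2 * Num.sqrt (harmonic n).
have ue n m : (n <= m)%N -> l2norm (u n - u m) <= e n.
  move=> nm; rewrite -(@ler_pXn2r _ 2)// ?nnegrE ?l2norm_ge0 ?mulr_ge0 ?sqrtr_ge0//.
  rewrite exprMn (sqr_sqrtr (ltW (harmonic_gt0 n))).
  have hm : harmonic m <= harmonic n :> R.
    by rewrite /harmonic/= lef_pV2 ?posrE// ler_nat.
  have := parallelogram (x - u m) (x - u n).
  have -> : x - u m - (x - u n) = u n - u m by rewrite opprB addrC subrKA.
  have -> : x - u m + (x - u n) = 2%:R *: (x - 2%:R^-1 *: (u m + u n)).
    rewrite scalerBr scalerA divff ?pnatr_eq0// scale1r scaler_nat mulr2n.
    by rewrite opprD addrACA.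
  rewrite l2norm_scale exprMn.
  have -> : normc (2%:R : R[i]) = 2 :> R.
    by rewrite normcMn normc1.
  have := dD _ (Nlin 2%:R^-1 (uN m) (Nlin 2%:R^-1 (uN n) N0)).
  rewrite addr0 -scalerDr.
  have := ud n; have := ud m; move: hm; move: (harmonic m) (harmonic n) => hm hn *; lra.
have e0 : e @ \oo --> (0 : R).
  rewrite -[X in _ --> X](mulr0 2) -[X in _ * X](sqrtr0 R).
  apply: cvgM; first exact: cvg_cst.
  by apply: continuous_cvg; [exact: sqrt_continuous|exact: cvg_harmonic].
have [p up] := l2_complete ue e0.
have uc : u @ \oo --> p.
  apply/(@cvg_l2P _ _ _ _ _ u) => r r0.
  have /cvgrPdist_lt/(_ _ r0) := e0; apply: filterS => n.
  rewrite sub0r normrN -l2normN opprB; apply: le_lt_trans.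
  by apply: le_trans (up n) _; exact: ler_norm.
exists p; first exact: Nclosed uN uc.
have pd : l2norm (x - p) ^+ 2 <= d.
  have xpn n : l2norm (x - p) <= Num.sqrt (d + harmonic n) + e n.
    rewrite -(subrKA (u n)); apply: le_trans (l2norm_triangle _ _) _.
    apply: lerD (up n); rewrite -(ger0_norm (l2norm_ge0 _)) -sqrtr_sqr.
    by apply: ler_wsqrtr; exact: ltW.
  have : (fun n => (Num.sqrt (d + harmonic n) + e n) ^+ 2) @ \oo --> d.
    have d0 : 0 <= d by apply: lb_le_inf.
    rewrite -[X in _ --> X](sqr_sqrtr d0) !expr2.
    have c : (fun n => Num.sqrt (d + harmonic n) + e n) @ \oo --> Num.sqrt d.
      rewrite -[X in _ --> X]addr0; apply: cvgD => //.
      apply: continuous_cvg; first exact: sqrt_continuous.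
      rewrite -[X in _ --> X]addr0; apply: cvgD; first exact: cvg_cst.
      exact: cvg_harmonic.
    by under eq_cvg do rewrite expr2; exact: cvgM.
  move=> /cvgr_to_ge; apply; exists 0%N => // n _.
  by rewrite !expr2; apply: ler_pM; rewrite ?l2norm_ge0 ?xpn.
move=> y Ny; rewrite -(@ler_pXn2r _ 2)// ?nnegrE ?l2norm_ge0//.
exact: le_trans pd (dD _ Ny).
Qed.

(** At the nearest point [p] the polynomial of [l2norm_shift], taken for [x - p]
and [v], has its minimum at [s = 0], which forces its linear coefficient to
vanish. *)
Lemma orthoprojP x :
  N (orthoproj N x) /\ orthocomplement N (x - orthoproj N x).
Proof.
have [p Np px] := nearest_point x.
apply: (@getPex _ [set p | N p /\ orthocomplement N (x - p)]).
exists p; split=> // v Nv; apply/eq0_normc/eqP.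
set t := inner _ _; have [//|t0] := eqVneq (normc t) 0.
have key (s : R) : 0 <= s * (s * l2norm v ^+ 2 - 2).
  have := px _ (Nlin (s%:C * t) Nv Np).
  have -> : x - ((s%:C * t) *: v + p) = x - p - (s%:C * t) *: v.
    by rewrite opprD addrA addrAC.
  move=> h; have {h} : l2norm (x - p) ^+ 2 <= l2norm (x - p - (s%:C * t) *: v) ^+ 2.
    by rewrite !expr2; apply: ler_pM; rewrite ?l2norm_ge0.
  rewrite /t l2norm_shift -/t.
  have t2 : 0 < normc t ^+ 2 by rewrite exprn_gt0// lt_def t0 normc_ge0.
  rewrite -(pmulr_rge0 _ t2) => h; lra.
have [v0|v0] := eqVneq (l2norm v ^+ 2) 0.
  by have := key 1; rewrite v0; lra.
have v1 : 0 < l2norm v ^+ 2 by rewrite lt_def v0 sqr_ge0.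
have := key (l2norm v ^+ 2)^-1; rewrite mulVf// pmulr_rge0 ?invr_gt0//; lra.
Qed.

End Projection.

(** * The coefficients of the reproducing kernel *)

Section EsumScale.
Context {R : realType} {I : choiceType}.

Lemma esumZ (D : set I) (c : R) (f : I -> \bar R) : 0 <= c ->
  (forall i, D i -> (0 <= f i)%E) ->
  (\esum_(i in D) (c%:E * f i) = c%:E * \esum_(i in D) f i)%E.
Proof.
move=> c0 f0.
have le_esumZ (t : R) (g : I -> \bar R) : 0 <= t ->
    (forall i, D i -> (0 <= g i)%E) ->
    (\esum_(i in D) (t%:E * g i) <= t%:E * \esum_(i in D) g i)%E.
  move=> t0 g0; apply: ge_ereal_sup => _ [A [finA AD] <-].
  rewrite !fsbig_finite//= big_seq -ge0_sume_distrr => [|i]; last first.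
    by rewrite in_fset_set// inE => /AD/g0.
  rewrite -big_seq lee_wpmul2l ?lee_fin//.
  by apply: ereal_sup_ubound; exists A; rewrite ?fsbig_finite.
have [->|c1] := eqVneq c 0.
  by rewrite mul0e esum1// => i _; rewrite mul0e.
apply/eqP; rewrite eq_le le_esumZ//= -lee_pdivlMl ?lt_def ?c1//.
apply: le_trans (le_esumZ c^-1 _ _ _); rewrite ?invr_ge0//.
  by apply: le_esum => i _; rewrite muleA -EFinM mulVf// mul1e.
by move=> i Di; rewrite mule_ge0// ?lee_fin// f0.
Qed.
End EsumScale.

Section Coefficients.
Context {R : realType} {n : nat}.
Variable a : seq 'I_n -> R.
Implicit Types (w : seq 'I_n) (p : nat).

(** The coefficients of the [p]-th power of the series [a], computed by
splitting off the first factor. *)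
Fixpoint power_coef p w : R :=
  if p is p'.+1 then
    \sum_(i < size w) a (take i.+1 w) * power_coef p' (drop i.+1 w)
  else (w == [::])%:R.

Fixpoint factorization_seq p w : seq (seq (seq 'I_n)) :=
  if p is p'.+1 then
    [seq take i.+1 w :: gs | i <- iota 0 (size w),
                             gs <- factorization_seq p' (drop i.+1 w)]
  else if w is [::] then [:: [::]] else [::].

Lemma factorization_seqP p w gs :
  gs \in factorization_seq p w <-> factorizations w p gs.
Proof.
elim: p w gs => [|p IHp] w gs /=.
  split; first by case: w => // /[!inE] /eqP ->.
  by case=> /size0nil -> <- _; rewrite inE.
split=> [/allpairsPdep[i [hs [+ /IHp[sh fh hh] ->]]]|].
  rewrite mem_iota/= => iw; split; rewrite /= ?sh ?fh ?cat_take_drop//.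
  by move=> g /[!inE] /orP[/eqP ->|/hh//]; rewrite size_take; case: ifP => //; lia.
case: gs => [[]//|g gs [/= [sg] fg hg]].
have g0 := hg _ (mem_head _ _).
have gE : (size g).-1.+1 = size g by rewrite prednK.
apply/allpairsPdep; exists (size g).-1, gs; split.
- by rewrite mem_iota /= add0n -fg size_cat gE leq_addr.
- apply/IHp; split=> //; first by rewrite -fg gE drop_size_cat.
  by move=> h hgs; apply: hg; rewrite inE hgs orbT.
- by rewrite -fg gE take_size_cat.
Qed.

Lemma factorization_seq_uniq p w : uniq (factorization_seq p w).
Proof.
elim: p w => [[]//|p IHp w /=]; apply: allpairs_uniq_dep => //.
  exact: iota_uniq.
move=> [i gs] [j hs] /allpairsPdep[i' [gs' [+ _ [-> _]]]]
  /allpairsPdep[j' [hs' [+ _ [-> _]]]] /=.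
rewrite !mem_iota /= => iw jw [/(congr1 size) + ->].
by rewrite !size_takel// => -[->].
Qed.

(** Both sides add over the length of the first factor; an explicit duplicate-free
list of the factorizations makes this a computation on lists. *)
Lemma power_coef_factorizations p w :
  \sum_(gs \in factorizations w p) \prod_(g <- gs) a g = power_coef p w.
Proof.
have -> : factorizations w p = [set` factorization_seq p w].
  by apply/seteqP; split=> gs /factorization_seqP.
rewrite -(fsbig_seq _ _ (factorization_seq_uniq p w)).
elim: p w => [[|j w]|p IHp w] /=; rewrite ?big_seq1 ?big_nil//.
rewrite big_allpairs_dep/=.
have -> : iota 0 (size w) = index_iota 0 (size w) by rewrite /index_iota subn0.
rewrite big_mkord.
apply: eq_bigr => i _; rewrite -IHp mulr_sumr; apply: eq_bigr => gs _.
by rewrite big_cons.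
Qed.

Lemma power_coef_out p w : (size w < p)%N -> power_coef p w = 0.
Proof.
elim: p w => // p IHp w wp /=; apply: big1 => i _.
by rewrite IHp ?mulr0// size_drop; have := ltn_ord i; lia.
Qed.

Hypothesis a_ge0 : forall w, 0 <= a w.

Lemma power_coef_ge0 p w : 0 <= power_coef p w.
Proof.
by elim: p w => [|p IHp] w /=; rewrite ?ler0n ?sumr_ge0// => i _; rewrite mulr_ge0.
Qed.

Arguments power_coef : simpl never.

Section Binomial.
Variable m : nat.
Let c p : R := 'C((p + m).-1, m.-1)%:R.

(** The summation bound may be any [N] beyond the length, since longer
factorizations into nonempty words do not exist; a common bound allows sums over
several words to be exchanged. *)
Lemma bcoefE N w : (size w <= N)%N ->
  bcoef a m w = \sum_(0 <= p < N.+1) c p * power_coef p w.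
Proof.
move=> wN; rewrite big_nat_recl//= /c add0n binn mul1r [power_coef 0 w]/=.
rewrite (@big_cat_nat _ _ _ (size w))//= [X in _ + (_ + X)]big_nat_cond.
rewrite [X in _ + (_ + X)]big1 ?addr0; last first.
  by move=> p /andP[/andP[wp _] _]; rewrite power_coef_out ?mulr0.
case: w wN => [|j w] wN; first by rewrite big_geq ?addr0.
rewrite add0r /bcoef big_add1; apply: eq_bigr => p _.
rewrite -power_coef_factorizations mulrC mulr_fsuml//.
Qed.

Lemma bcoef_ge0 w : 0 <= bcoef a m w.
Proof.
rewrite (bcoefE (leqnn _)) sumr_ge0// => p _.
by rewrite mulr_ge0 ?ler0n ?power_coef_ge0.
Qed.

(** Prepending a factor to a factorization can only increase the binomial
weight, so [b] dominates the convolution of [a] and [b]. *)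
Lemma bcoef_convolution w : w != [::] ->
  \sum_(i < size w) a (take i.+1 w) * bcoef a m (drop i.+1 w) <= bcoef a m w.
Proof.
case: w => // j w _; set N := size w.
have -> : \sum_(i < size (j :: w))
      a (take i.+1 (j :: w)) * bcoef a m (drop i.+1 (j :: w)) =
    \sum_(0 <= p < N.+1) c p * power_coef p.+1 (j :: w).
  under eq_bigr => i _.
    rewrite (@bcoefE N) ?mulr_sumr; last first.
      by rewrite size_drop /=; have := ltn_ord i; lia.
    under eq_bigr do rewrite mulrCA.
    over.
  rewrite exchange_big /=; apply: eq_bigr => p _.
  by rewrite mulr_sumr.
rewrite (@bcoefE N.+1) // [leRHS]big_nat_recl//= mulr0 add0r.
apply: ler_sum => p _; rewrite ler_wpM2r//.
  exact: (power_coef_ge0 p.+1 (j :: w)).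
by rewrite ler_nat leq_bin2l//; lia.
Qed.

(** This bounds the weights of the shifts. *)
Lemma bcoef_cons j w : a [:: j] * bcoef a m w <= bcoef a m (j :: w).
Proof.
apply: le_trans (@bcoef_convolution (j :: w) isT).
rewrite /= big_ord_recl/= take0 drop0 lerDl sumr_ge0// => i _.
by rewrite mulr_ge0 ?bcoef_ge0.
Qed.

Lemma bcoef_gt0 w : (forall j, 0 < a [:: j]) -> 0 < bcoef a m w.
Proof.
move=> a1; elim: w => [|j w IHw]; first exact: ltr01.
by apply: lt_le_trans (bcoef_cons j w); rewrite mulr_gt0.
Qed.

End Binomial.
End Coefficients.

(** * Summability of the kernel in one variable *)

(** The sum is a truncation of the expansion of [(1 - q) ^ - m.+1]; by Pascal's
rule the sum for [m.+1] is at most the sum for [m] plus [q] times itself. *)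
Lemma negative_binomial_le {R : realFieldType} (q : R) (m N : nat) :
  0 <= q -> q < 1 ->
  (1 - q) ^+ m.+1 * \sum_(0 <= p < N) 'C(p + m, m)%:R * q ^+ p <= 1.
Proof.
move=> q0 q1; have q1' : 0 <= 1 - q by rewrite subr_ge0 ltW.
elim: m => [|m IHm].
  under eq_bigr do rewrite addn0 bin0 mul1r.
  rewrite expr1 big_mkord -opprB mulNr -subrX1 opprB lerBlDr lerDl.
  exact: exprn_ge0.
set S := \sum_(0 <= p < N) _ * _.
suff SE : S <= \sum_(0 <= p < N) 'C(p + m, m)%:R * q ^+ p + q * S.
  apply: le_trans IHm; rewrite exprSr -mulrA ler_wpM2l ?exprn_ge0//.
  lra.
rewrite /S; case: (N) => [|N1]; first by rewrite !big_geq// mulr0 addr0.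
rewrite {1}[X in _ <= _ + q * X]big_nat_recr//= mulrDr addrA.
apply: ler_wpDr; first by rewrite !mulr_ge0 ?exprn_ge0.
rewrite [leLHS]big_nat_recl// [X in _ <= X + _]big_nat_recl// -addrA.
rewrite !binn lerD2l mulr_sumr -big_split/=; apply: ler_sum => p _.
rewrite mulrCA -exprS -mulrDl ler_wpM2r ?exprn_ge0//.
by rewrite -natrD ler_nat !addSn addnS binS addnC.
Qed.

Section WeightedSums.
Context {R : realType} {n : nat}.
Variables (a x : seq 'I_n -> R).
Hypothesis a_ge0 : forall w, 0 <= a w.
Hypothesis x_ge0 : forall w, 0 <= x w.
Hypothesis x_nil : x [::] = 1.
Hypothesis x_cat : forall u v, x (u ++ v) = x u * x v.

Let Psi : \bar R :=
  (\esum_(w in [set w : seq 'I_n | (1 <= size w)%N]) (a w * x w)%:E)%E.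

(** Splitting a word at each of its positions is a bijection onto the pairs with
nonempty first component, and [x] is multiplicative. *)
Lemma esum_convolution (f : seq 'I_n -> R) (S : R) : (forall w, 0 <= f w) ->
  (\esum_(w in [set: seq 'I_n]) (f w * x w)%:E)%E = S%:E ->
  (\esum_(w in [set: seq 'I_n])
     ((\sum_(i < size w) a (take i.+1 w) * f (drop i.+1 w)) * x w)%:E)%E =
  (S%:E * Psi)%E.
Proof.
move=> f0 SE.
have S0 : 0 <= S.
  by rewrite -lee_fin -SE esum_ge0// => w _; rewrite lee_fin mulr_ge0.
pose G u v := ((a u * x u)%:E * (f v * x v)%:E)%E.
have G0 u v : (0 <= G u v)%E by rewrite /G -EFinM lee_fin !mulr_ge0.
have -> : (S%:E * Psi = \esum_(u in [set u : seq 'I_n | (1 <= size u)%N])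
    \esum_(v in [set: seq 'I_n]) G u v)%E.
  rewrite -esumZ//; last by move=> u _; rewrite lee_fin mulr_ge0.
  apply: eq_esum => u _; rewrite muleC -SE -esumZ ?mulr_ge0// => v _.
  by rewrite lee_fin mulr_ge0.
rewrite esum_esum//.
pose D := [set: seq 'I_n] `*`` (fun w => `I_(size w)).
rewrite (@reindex_esum _ _ _ D _
    (fun wi : seq 'I_n * nat => (take wi.2.+1 wi.1, drop wi.2.+1 wi.1))); last first.
  split.
  - move=> [w i] [_ /= iw]; split=> //=; rewrite size_take; case: ifP => //; lia.
  - move=> [w i] [v j] /set_mem[_ /= iw] /set_mem[_ /= jv] [tt dd].
    have := congr1 size tt; rewrite !size_takel// => -[ij].
    by rewrite -(cat_take_drop i.+1 w) tt dd ij cat_take_drop.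
  - move=> [u v] [/= u1 _]; exists (u ++ v, (size u).-1) => /=.
      by split=> //=; rewrite size_cat prednK// leq_addr.
    by rewrite prednK// take_size_cat// drop_size_cat.
rewrite -(@esum_esum _ _ _ _ _
  (fun w (i : nat) => G (take i.+1 w) (drop i.+1 w)))//.
apply: eq_esum => w _.
rewrite esum_fset// -fsbig_ord mulr_suml -sumEFin; apply: eq_bigr => i _.
have -> : x w = x (take i.+1 w) * x (drop i.+1 w) by rewrite -x_cat cat_take_drop.
by rewrite /G -EFinM; congr EFin; ring.
Qed.

Lemma esum_power_coef (q : R) p : Psi = q%:E ->
  (\esum_(w in [set: seq 'I_n]) (power_coef a p w * x w)%:E)%E = (q ^+ p)%:E.
Proof.
move=> qE; elim: p => [|p IHp].
  rewrite (esumID [set [::]])// => [|w _]; last first.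
    by rewrite lee_fin mulr_ge0// ler0n.
  rewrite !setTI esum_set1 ?mul1r ?x_nil ?lee_fin//.
  rewrite esum1 ?adde0 ?expr0// => w /= /eqP/negPf w0.
  by rewrite /power_coef w0 mul0r.
have := esum_convolution (power_coef_ge0 a_ge0 p) IHp.
by rewrite qE -EFinM -exprSr => <-; apply: eq_esum => w _.
Qed.

(** The [p]-th power of [a] has total [Psi ^ p] and enters [b] with a binomial
factor, so every finite sum is bounded by the negative binomial series at
[Psi]. *)
Lemma bcoef_sum_finite m : (0 < m)%N -> (Psi < 1)%E ->
  (\esum_(w in [set: seq 'I_n]) (bcoef a m w * x w)%:E < +oo)%E.
Proof.
case: m => // m _ Psi1.
have Psi0 : (0 <= Psi)%E by apply: esum_ge0 => w _; rewrite lee_fin mulr_ge0.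
have PsiE : Psi = (fine Psi)%:E.
  by rewrite fineK// ge0_fin_numE// (lt_trans Psi1)// ltry.
move: PsiE; set q := fine _ => PsiE.
have q0 : 0 <= q by rewrite -lee_fin -PsiE.
have q1 : q < 1 by rewrite -lte_fin -PsiE.
have q1' : 0 < (1 - q) ^+ m.+1 by rewrite exprn_gt0// subr_gt0.
apply: (@le_lt_trans _ _ (((1 - q) ^+ m.+1)^-1)%:E); last exact: ltry.
apply: esum_le_fset => A; rewrite sumEFin lee_fin.
pose N := (\max_(w <- A) size w)%N.
rewrite big_seq; under eq_bigr => w wA.
  rewrite (@bcoefE _ _ _ m.+1 N); last exact: leq_bigmax_seq.
  rewrite mulr_suml; under eq_bigr do rewrite -mulrA addnS.
  over.
rewrite -big_seq exchange_big/=.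
rewrite -[leRHS]mulr1 ler_pdivlMl//.
apply: le_trans (negative_binomial_le m N.+1 q0 q1).
rewrite ler_wpM2l ?(ltW q1')//; apply: ler_sum => p _.
rewrite -mulr_sumr ler_wpM2l// -lee_fin -(esum_power_coef p PsiE) -sumEFin.
exact: fset_le_esum.
Qed.

(** By [bcoef_convolution] the total [s] satisfies [1 + s * Psi <= s], the empty
word contributing [1]. *)
Lemma bcoef_sum_finite_lt1 m :
  (\esum_(w in [set: seq 'I_n]) (bcoef a m w * x w)%:E < +oo)%E -> (Psi < 1)%E.
Proof.
set S := (X in (X < _)%E) => Soo.
have b0 w : 0 <= bcoef a m w by apply: bcoef_ge0.
have S0 : (0 <= S)%E by apply: esum_ge0 => w _; rewrite lee_fin mulr_ge0.
have SE : S = (fine S)%:E by rewrite fineK// ge0_fin_numE.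
move: SE; set s := fine _ => SE.
have Psi0 : (0 <= Psi)%E by apply: esum_ge0 => w _; rewrite lee_fin mulr_ge0.
have : (1 + s%:E * Psi <= s%:E)%E.
  rewrite -(esum_convolution b0 SE) -SE.
  have -> : (1 = \esum_(w in [set: seq 'I_n]) ((w == [::])%:R * x w)%:E)%E.
    have := @esum_power_coef 0 0.
    rewrite (esumID [set [::]])// => [|w _]; last first.
      by rewrite lee_fin mulr_ge0// ler0n.
    rewrite !setTI esum_set1 ?mul1r ?x_nil ?lee_fin// => _.
    rewrite esum1 ?adde0// => w /= /eqP/negPf w0.
    by rewrite w0 mul0r.
  rewrite -esumD; first last.
  - by move=> w _; rewrite lee_fin mulr_ge0// sumr_ge0// => i _; rewrite mulr_ge0.
  - by move=> w _; rewrite lee_fin mulr_ge0// ler0n.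
  apply: le_esum => w _; rewrite -EFinD lee_fin -mulrDl ler_wpM2r//.
  have [->|w0] := eqVneq w [::]; first by rewrite big_ord0 addr0.
  by rewrite add0r bcoef_convolution.
have s0 : 0 <= s by rewrite -lee_fin -SE.
case: Psi Psi0 => [q q0|_|//].
  rewrite -EFinM -EFinD lee_fin lte_fin => h; rewrite ltNge; apply/negP => q1.
  have : s * 1 <= s * q by rewrite ler_wpM2l.
  lra.
have [->|s1] := eqVneq s 0; first by rewrite mul0e adde0 lee_fin ler10.
by rewrite gt0_muley ?lte_fin ?lt_def ?s1.
Qed.

End WeightedSums.

(** * Weighted shifts and their adjoints *)

Section LinearMaps.
Variable K : pzRingType.

Lemma linear0P (U V : lmodType K) (T : U -> V) : linear T -> T 0 = 0.
Proof. by move=> Tl; have := Tl (-1) 0 0; rewrite !scaleN1r !addNr. Qed.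

Lemma linearZP (U V : lmodType K) (T : U -> V) c (x : U) :
  linear T -> T (c *: x) = c *: T x.
Proof. by move=> Tl; have := Tl c x 0; rewrite (linear0P Tl) !addr0. Qed.

Lemma linearBP (U V : lmodType K) (T : U -> V) (x y : U) :
  linear T -> T (x - y) = T x - T y.
Proof. by move=> Tl; rewrite addrC -scaleN1r Tl scaleN1r addrC. Qed.

End LinearMaps.

Section Reindexing.
Context {R : realType}.

(** One estimate for the weighted shifts in one and in several variables and for
their adjoints: each of them moves coordinates along an injection with bounded
weights. *)
Lemma weighted_transport (I I' : choiceType) (s : I -> I') (x : l2 R I)
    (y : I' -> R[i]) (C : R) : injective s -> 0 <= C ->
  (forall i', (forall i, i' <> s i) -> y i' = 0) ->
  (forall i, normc (y (s i)) <= C * normc (x i)) ->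
  y \in sqsummable /\ l2norm (mkl2 y) <= C * l2norm x.
Proof.
move=> sinj C0 y0 yx.
have yA (A : {fset I'}) :
    \sum_(i <- A) normc (y i) ^+ 2 <= (C * l2norm x) ^+ 2.
  rewrite (big_fset_preimage (f := fun i => normc (y i) ^+ 2) A sinj); last first.
    by move=> i /y0 ->; rewrite normc0 expr0n.
  set B := fset_set _.
  apply: (@le_trans _ _ (\sum_(i <- B) C ^+ 2 * normc (x i) ^+ 2)).
    apply: ler_sum => i _; rewrite -exprMn !expr2.
    by apply: ler_pM; rewrite ?normc_ge0.
  by rewrite -mulr_sumr exprMn ler_wpM2l ?sqr_ge0 ?sqsum_fset.
have yS := sqsummable_fset yA.
by split=> //; apply: l2norm_le => [|A]; rewrite ?mulr_ge0 ?l2norm_ge0// mkl2E.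
Qed.

Lemma sqsummable_comp (I I' : choiceType) (s : I' -> I) (x : l2 R I) :
  injective s -> (fun i => x (s i)) \in sqsummable.
Proof.
move=> sinj; apply: (@sqsummable_fset _ _ _ (l2norm x ^+ 2)) => A.
apply: le_trans (sqsum_fset x (s @` A)%fset).
by rewrite big_imfset//= => ? ? _ _; exact: sinj.
Qed.

End Reindexing.

Section Multiwords.
Context {k : nat} {n : 'I_k -> nat}.
Implicit Types (i : 'I_k) (beta : multiword n).

Lemma multiwordP (beta gamma : multiword n) :
  (forall i, beta i = gamma i) -> beta = gamma.
Proof. by move=> bg; apply/ffunP. Qed.

Lemma replace_in beta i (w : seq 'I_(n i)) : replace beta w i = w.
Proof. by rewrite ffunE dfwith_in. Qed.

Lemma replace_out beta i (w : seq 'I_(n i)) i' :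
  i' != i -> replace beta w i' = beta i'.
Proof. by move=> ii'; rewrite ffunE dfwith_out// eq_sym. Qed.

Lemma replace_replace beta i (v w : seq 'I_(n i)) :
  replace (replace beta v) w = replace beta w.
Proof.
apply: multiwordP => i'; have [->|ii'] := eqVneq i' i.
  by rewrite !replace_in.
by rewrite !replace_out.
Qed.

Lemma replace_id beta i : replace beta (beta i) = beta.
Proof.
apply: multiwordP => i'; have [->|ii'] := eqVneq i' i.
  by rewrite replace_in.
by rewrite replace_out.
Qed.

Lemma replace_inj beta i : injective (@replace k n beta i).
Proof. by move=> v w /(congr1 (fun g : multiword n => g i)); rewrite !replace_in. Qed.

Definition push i (j : 'I_(n i)) beta : multiword n := replace beta (j :: beta i).

Lemma push_inj i (j : 'I_(n i)) : injective (push j).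
Proof.
move=> beta gamma bg; apply: multiwordP => i'.
have := congr1 (fun g : multiword n => g i') bg; rewrite /push.
have [->|ii'] := eqVneq i' i; first by rewrite !replace_in => -[].
by rewrite !replace_out.
Qed.

Lemma push_replace beta i (j : 'I_(n i)) w :
  beta i = j :: w -> beta = push j (replace beta w).
Proof. by move=> bw; rewrite /push replace_in replace_replace -bw replace_id. Qed.

Lemma prod_replace (V : comPzSemiRingType) (F : forall i, seq 'I_(n i) -> V) beta i
    (w : seq 'I_(n i)) c : F i w = c * F i (beta i) ->
  \prod_i' F i' (replace beta w i') = c * \prod_i' F i' (beta i').
Proof.
move=> Fw; rewrite (bigD1 i)//= [in RHS](bigD1 i)//= replace_in Fw mulrA.
by congr (_ * _); apply: eq_bigr => i' ii'; rewrite replace_out.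
Qed.

Definition empty_word : multiword n := finfun (fun i => [::]).

Lemma empty_wordE i : empty_word i = [::].
Proof. by rewrite ffunE. Qed.

(** Induction on the total length: a nonempty component gives a letter to
remove. *)
Lemma multiword_ind (P : multiword n -> Prop) : P empty_word ->
  (forall i (j : 'I_(n i)) beta, P beta -> P (push j beta)) ->
  forall beta, P beta.
Proof.
move=> P0 PS beta; have [N] := ubnP (\sum_i size (beta i)); elim: N beta => // N IHN beta.
rewrite ltnS => betaN.
have [b0|nb0] := pselect (forall i, beta i = [::]).
  suff -> : beta = empty_word by [].
  by apply: multiwordP => i; rewrite empty_wordE.
move: nb0 => /existsNP[i0]; case E : (beta i0) => [//|j w] _.
rewrite (push_replace E); apply: PS; apply: IHN; apply: leq_trans betaN.
rewrite (bigD1 i0)//= [leqRHS](bigD1 i0)//= replace_in E /= addSn ltnS leq_add2l.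
by apply: leq_sum => i' ii'; rewrite replace_out.
Qed.

End Multiwords.

Section Shifts.
Context {R : realType} {k : nat} {n : 'I_k -> nat}.
Variables (a : forall i : 'I_k, seq 'I_(n i) -> R) (m : 'I_k -> nat).
Hypothesis a_ge0 : forall i (w : seq 'I_(n i)), 0 <= a w.
Hypothesis a_gt0 : forall i (j : 'I_(n i)), 0 < a [:: j].
Implicit Types (i : 'I_k) (beta : multiword n) (h x : fock R n).

Local Notation b i w := (bcoef (@a i) (m i) w).

Lemma b_gt0 i (w : seq 'I_(n i)) : 0 < b i w.
Proof. exact: bcoef_gt0. Qed.

Definition shift_weight i (j : 'I_(n i)) w : R := Num.sqrt (b i w / b i (j :: w)).

Lemma shift_weight_le i (j : 'I_(n i)) w :
  normc (shift_weight j w)%:C <= Num.sqrt (a [:: j])^-1.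
Proof.
rewrite normcR ger0_norm ?sqrtr_ge0// ler_wsqrtr// ler_pdivrMr ?b_gt0//.
rewrite ler_pdivlMl//; exact: bcoef_cons.
Qed.

Lemma creationE i (j : 'I_(n i)) (x : fock1 R (n i)) w :
  creation (@a i) (m i) j x w =
  if w is j' :: w' then
    if j' == j then (shift_weight j w')%:C * x w' else 0
  else 0.
Proof.
rewrite /creation mkl2E; last first.
  have [] // := @weighted_transport _ _ _ (cons j) x (fun w => if w is j' :: w' then
      if j' == j then (Num.sqrt (b i w' / b i w))%:C * x w' else 0 else 0)
      (Num.sqrt (a [:: j])^-1).
  - by move=> v v' [].
  - case=> // j' w' jw; case: eqVneq => // jj'.
    by case: (jw w'); rewrite jj'.
  - move=> v; rewrite eqxx normcM ler_wpM2r ?normc_ge0//.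
    exact: shift_weight_le.
by case: w => // j' w; case: eqVneq => // ->.
Qed.

Definition weighted_shift i (j : 'I_(n i)) (x : multiword n -> R[i]) beta : R[i] :=
  if beta i is j' :: w then
    if j' == j then (shift_weight j w)%:C * x (replace beta w) else 0
  else 0.

Lemma weighted_shift_push i (j : 'I_(n i)) (x : multiword n -> R[i]) beta :
  weighted_shift j x (push j beta) = (shift_weight j (beta i))%:C * x beta.
Proof.
by rewrite /weighted_shift /push replace_in eqxx replace_replace replace_id.
Qed.

(** Together with [weighted_shift_push] this describes a weighted shift as a
transport along the injection [push j]. *)
Lemma weighted_shift_off i (j : 'I_(n i)) (x : multiword n -> R[i]) gamma :
  (forall beta, gamma <> push j beta) -> weighted_shift j x gamma = 0.
Proof.
rewrite /weighted_shift; case E : (gamma i) => [//|j' w] jg.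
by case: eqVneq => // jj'; case: (jg _ (push_replace (etrans E (congr1 (cons^~ w) jj')))).
Qed.

Lemma weighted_shift_transport i (j : 'I_(n i)) x :
  weighted_shift j x \in sqsummable /\
  l2norm (mkl2 (weighted_shift j x)) <= Num.sqrt (a [:: j])^-1 * l2norm x.
Proof.
apply: (weighted_transport (s := push j)); rewrite ?sqrtr_ge0//.
- exact: push_inj.
- exact: weighted_shift_off.
- move=> beta; rewrite weighted_shift_push normcM ler_wpM2r ?normc_ge0//.
  exact: shift_weight_le.
Qed.

Lemma WopE i (j : 'I_(n i)) x : Wop a m j x = mkl2 (weighted_shift j x).
Proof.
rewrite /Wop /ampliation; congr mkl2; apply/funext => beta.
by rewrite creationE mkl2E//; apply: sqsummable_comp; exact: replace_inj.
Qed.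

Lemma Wop_val i (j : 'I_(n i)) x beta : Wop a m j x beta = weighted_shift j x beta.
Proof. by rewrite WopE mkl2E//; case: (weighted_shift_transport j x). Qed.

Lemma Wop_linear i (j : 'I_(n i)) : linear (Wop a m j).
Proof.
move=> c x y; apply: l2P => beta.
rewrite Wop_val.
transitivity (c * weighted_shift j x beta + weighted_shift j y beta); last first.
  by rewrite /= -2!Wop_val.
rewrite /weighted_shift; case: (beta i) => [|j' w]; first by rewrite mulr0 addr0.
case: eqVneq => _; last by rewrite mulr0 addr0.
by rewrite l2_scale_add mulrDr mulrCA.
Qed.

Lemma Wop_bounded i (j : 'I_(n i)) : bounded_operator (Wop a m j).
Proof.
split; first exact: Wop_linear.
move=> x; apply/(@cvg_l2P _ _ _ (nbhs x) (nbhs_filter x) (Wop a m j)) => e e0.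
set C := Num.sqrt (a [:: j])^-1.
have C1 : 0 < C + 1 by rewrite ltr_wpDl ?sqrtr_ge0.
have /(@cvg_l2P _ _ _ (nbhs x) (nbhs_filter x) id)/(_ _ (divr_gt0 e0 C1)) :=
  @cvg_id _ (nbhs x).
apply: filterS => y xy; rewrite -(linearBP _ _ (Wop_linear j)) WopE.
apply: le_lt_trans (weighted_shift_transport j _).2 _.
rewrite ltr_pdivlMr// in xy; apply: le_lt_trans xy.
by rewrite mulrC ler_wpM2l ?l2norm_ge0// lerDl.
Qed.

Definition Wadj i (j : 'I_(n i)) h : fock R n :=
  mkl2 (fun beta => (shift_weight j (beta i))%:C * h (push j beta)).

Lemma WadjE i (j : 'I_(n i)) h beta :
  Wadj j h beta = (shift_weight j (beta i))%:C * h (push j beta).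
Proof.
rewrite /Wadj mkl2E//.
pose h' : fock R n := mkl2 (fun beta => h (push j beta)).
have h'E beta' : h' beta' = h (push j beta').
  by rewrite mkl2E//; apply: sqsummable_comp; exact: push_inj.
have [] // := @weighted_transport _ _ _ id h'
  (fun beta => (shift_weight j (beta i))%:C * h (push j beta))
  (Num.sqrt (a [:: j])^-1) _ _ _ _; rewrite ?sqrtr_ge0//.
- by move=> gamma /(_ gamma).
- move=> beta'; rewrite h'E normcM ler_wpM2r ?normc_ge0//.
  exact: shift_weight_le.
Qed.

(** The terms of the left-hand side are supported on the range of [push j]. *)
Lemma inner_Wadj i (j : 'I_(n i)) x h :
  inner (Wop a m j x) h = inner x (Wadj j h).
Proof.
apply/esym/inner_eq.
have := sum_reindex (@push_inj k n i j) _ (inner_cvg (Wop a m j x) h).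
rewrite (_ : _ \o _ = fun beta => x beta * (Wadj j h beta)^*).
  by apply => gamma jg; rewrite Wop_val weighted_shift_off// mul0r.
apply/funext => beta; rewrite /= Wop_val weighted_shift_push WadjE conjM conjR.
by rewrite [in RHS]mulrCA mulrA.
Qed.

End Shifts.

(** * Sums of products over multiwords *)

Section ProductSums.
Context {R : realType} {k : nat} {n : 'I_k -> nat}.

(** Distributivity over the coordinates: a finite set of multiwords lies in the
product of its projections, over which the sum of products is a product of
sums.  The projection to coordinate [i] is represented inside [A] itself, by
one chosen multiword for each word that occurs there. *)
Lemma sum_prod_le (F : forall i, seq 'I_(n i) -> R) (S : 'I_k -> R) :
  (forall i w, 0 <= F i w) ->
  (forall i (B : {fset seq 'I_(n i)}), \sum_(w <- B) F i w <= S i) ->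
  forall A : {fset multiword n},
    \sum_(beta <- A) \prod_i F i (beta i) <= \prod_i S i.
Proof.
move=> F0 FS A; rewrite big_seq_fsetE/=.
pose rep i (beta : A) : A :=
  odflt beta [pick gamma : A | val gamma i == val beta i].
have repE i beta : val (rep i beta) i = val beta i.
  by rewrite /rep; case: pickP => [gamma /eqP|].
have rep_eq i (beta gamma : A) : val beta i = val gamma i -> rep i beta = rep i gamma.
  rewrite /rep => bg; rewrite bg.
  by case: pickP => // /(_ gamma); rewrite eqxx.
pose Q i : pred A := fun beta => rep i beta == beta.
pose G (f : {ffun 'I_k -> A}) := \prod_i F i (val (f i) i).
have G0 f : 0 <= G f by apply: prodr_ge0.
pose H (beta : A) := [ffun i => rep i beta].
have Hinj : injective H.
  move=> beta gamma bg; apply/val_inj/multiwordP => i.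
  have /(congr1 (fun f : {ffun 'I_k -> A} => f i)) := bg.
  by rewrite !ffunE => /(congr1 (fun g : A => val g i)); rewrite !repE.
have -> : \sum_(beta : A) \prod_i F i (val beta i) = \sum_(f in [set H beta | beta : A]) G f.
  rewrite big_imset/=; last by move=> ? ? _ _; exact: Hinj.
  by apply: eq_bigr => beta _; apply: eq_bigr => i _; rewrite ffunE repE.
apply: (@le_trans _ _ (\sum_(f in family Q) G f)).
  rewrite [leRHS](bigID (mem [set H beta | beta : A]))/=.
  rewrite [X in X + _](_ : _ = \sum_(f in [set H beta | beta : A]) G f).
    by rewrite lerDl sumr_ge0.
  apply: eq_bigl => f; rewrite andbC; case: (boolP (f \in _)) => // /imsetP[beta _ ->].
  apply/familyP => i; rewrite ffunE; change (rep i (rep i beta) == rep i beta).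
  by apply/eqP/rep_eq/repE.
rewrite -(bigA_distr_big_dep _ (fun i (beta : A) => F i (val beta i))).
apply: ler_prod => i _; rewrite sumr_ge0//=.
pose s := [seq (val (beta : A) : multiword n) i | beta <- enum (Q i)].
have us : uniq s.
  rewrite map_inj_in_uniq ?enum_uniq// => beta gamma.
  rewrite !mem_enum => /eqP <- /eqP <-; rewrite !repE; exact: rep_eq.
apply: le_trans (FS i [fset w in s]%fset).
rewrite [leRHS](perm_big s)/=; first by rewrite big_map big_enum.
by apply: uniq_perm; rewrite ?fset_uniq// => w; rewrite !inE.
Qed.

End ProductSums.

Section EvalWord.
Context {R : realType} {n : nat}.
Implicit Types (z : 'rV[R[i]]_n) (u v w : seq 'I_n).

Lemma eval_word_nil z : eval_word z [::] = 1.
Proof. by rewrite /eval_word big_nil. Qed.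

Lemma eval_word_cons z j w : eval_word z (j :: w) = z 0 j * eval_word z w.
Proof. by rewrite /eval_word big_cons. Qed.

Lemma eval_word_cat z u v : eval_word z (u ++ v) = eval_word z u * eval_word z v.
Proof. by rewrite /eval_word big_cat. Qed.
End EvalWord.

(** * The Berezin kernel as an eigenvector *)

Section Kernel.
Context {R : realType} {k : nat} {n : 'I_k -> nat}.
Variables (a : forall i : 'I_k, seq 'I_(n i) -> R) (m : 'I_k -> nat).
Hypothesis a_ge0 : forall i (w : seq 'I_(n i)), 0 <= a w.
Hypothesis a_gt0 : forall i (j : 'I_(n i)), 0 < a [:: j].
Implicit Types (i : 'I_k) (beta : multiword n) (h x : fock R n).
Implicit Types (z : forall i, 'rV[R[i]]_(n i)).

Local Notation b i w := (bcoef (@a i) (m i) w).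
Local Notation Wadj := (@Wadj R k n a m _).

Definition root_weight beta : R := \prod_i Num.sqrt (b i (beta i)).

Lemma root_weight_gt0 beta : 0 < root_weight beta.
Proof. by apply: prodr_gt0 => i _; rewrite sqrtr_gt0 bcoef_gt0. Qed.

Lemma shift_weight_gt0 i (j : 'I_(n i)) w : 0 < shift_weight a m j w.
Proof. by rewrite sqrtr_gt0 divr_gt0// bcoef_gt0. Qed.

Lemma root_weight_push i (j : 'I_(n i)) beta :
  shift_weight a m j (beta i) = root_weight beta / root_weight (push j beta).
Proof.
have b0 w : 0 < b i w by apply: bcoef_gt0.
apply: (canRL (mulfK (lt0r_neq0 (root_weight_gt0 _)))).
rewrite /root_weight /push.
rewrite (@prod_replace _ _ _ (fun i w => Num.sqrt (b i w)) _ _ _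
  (shift_weight a m j (beta i))^-1).
  by rewrite mulVKf// lt0r_neq0// shift_weight_gt0.
rewrite -[LHS](mulKf (lt0r_neq0 (shift_weight_gt0 j (beta i)))); congr (_ * _).
by rewrite -sqrtrM ?divr_ge0 ?(ltW (b0 _))// divfK ?lt0r_neq0.
Qed.

Definition kernel_coef z beta : R[i] :=
  (\prod_i (eval_word (z i) (beta i))^*) * (root_weight beta)%:C.

Definition berezin_kernel z : fock R n := mkl2 (kernel_coef z).

Lemma kernel_coef_conj z beta :
  kernel_coef z beta = (eval_multiword z beta)^* * (root_weight beta)%:C.
Proof. by rewrite /kernel_coef conj_prod. Qed.

Lemma eval_multiword_push z i (j : 'I_(n i)) beta :
  eval_multiword z (push j beta) = z i 0 j * eval_multiword z beta.
Proof.
rewrite /eval_multiword /push.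
by rewrite (@prod_replace _ _ _ (fun i w => eval_word (z i) w) _ _ _ (z i 0 j))//
  eval_word_cons.
Qed.

(** The weight of the shift is the ratio that the factor [root_weight] loses, so
only the letter's scalar remains. *)
Lemma kernel_coef_push z i (j : 'I_(n i)) beta :
  (shift_weight a m j (beta i))%:C * kernel_coef z (push j beta) =
  (z i 0 j)^* * kernel_coef z beta.
Proof.
rewrite !kernel_coef_conj eval_multiword_push conjM root_weight_push mulrCA.
rewrite -(rmorphM (real_complex R)) divfK ?lt0r_neq0 ?root_weight_gt0//.
by rewrite mulrA.
Qed.

Lemma kernel_coef_empty z : kernel_coef z (empty_word (n := n)) = 1.
Proof.
rewrite /kernel_coef /root_weight !big1 ?rmorph1 ?mulr1// => i _.
  by rewrite empty_wordE sqrtr1.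
by rewrite empty_wordE eval_word_nil conj1.
Qed.

Lemma normc_prod (F : 'I_k -> R[i]) : normc (\prod_i F i) = \prod_i normc (F i).
Proof. by elim/big_rec2 : _ => [|i y z _ <-]; rewrite ?normc1 ?normcM. Qed.

Lemma normc_kernel_coef z beta : normc (kernel_coef z beta) ^+ 2 =
  \prod_i (b i (beta i) * normc (eval_word (z i) (beta i)) ^+ 2).
Proof.
rewrite /kernel_coef normcM normcR (ger0_norm (ltW (root_weight_gt0 _))).
rewrite normc_prod -big_split/= -prodrXl; apply: eq_bigr => i _.
by rewrite normcJ_eq exprMn mulrC sqr_sqrtr// bcoef_ge0.
Qed.

(** The squared modulus of the family is a product over the coordinates.  On the
multiwords with a single nonempty coordinate it reduces to one factor, which
gives the domain condition; conversely the product of the totals of the factors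
bounds all finite sums. *)
Lemma kernel_sqsummableP z : (forall i, 0 < m i)%N ->
  (kernel_coef z \in sqsummable) <-> scalar_polydomain a z.
Proof.
move=> m0.
have x_ge0 i w : 0 <= normc (eval_word (z i) w) ^+ 2 by rewrite sqr_ge0.
have x_nil i : normc (eval_word (z i) [::]) ^+ 2 = 1.
  by rewrite eval_word_nil normc1 expr1n.
have x_cat i u v : normc (eval_word (z i) (u ++ v)) ^+ 2 =
    normc (eval_word (z i) u) ^+ 2 * normc (eval_word (z i) v) ^+ 2.
  by rewrite eval_word_cat normcM exprMn.
have b_ge0 i w : 0 <= b i w by apply: bcoef_ge0.
split=> [/asboolP kS i|zD].
  apply: (@bcoef_sum_finite_lt1 _ _ _ _ (@a_ge0 i) (x_ge0 i) (x_nil i) (x_cat i) (m i)).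
  have inj := @replace_inj k n (empty_word (n := n)) i.
  have kF : (fun beta => berezin_kernel z beta) = kernel_coef z.
    by apply/funext => beta; rewrite mkl2E//; apply/asboolP.
  have /asboolP := sqsummable_comp (berezin_kernel z) inj.
  rewrite (_ : (fun w => _) = fun w => kernel_coef z (replace (empty_word (n := n)) w)); last first.
    by apply/funext => w; rewrite -kF.
  rewrite /sqsum; apply: le_lt_trans; apply: le_esum => w _.
  rewrite normc_kernel_coef (bigD1 i)//= replace_in big1 ?mulr1// => i' ii'.
  by rewrite replace_out// empty_wordE x_nil mulr1.
pose F i w := b i w * normc (eval_word (z i) w) ^+ 2.
pose S i : R := fine (\esum_(w in [set: seq 'I_(n i)]) (F i w)%:E)%E.
apply: (@sqsummable_fset _ _ (kernel_coef z) (\prod_i S i)) => A.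
have -> : \sum_(beta <- A) normc (kernel_coef z beta) ^+ 2 =
    \sum_(beta <- A) \prod_i F i (beta i).
  by apply: eq_bigr => beta _; exact: normc_kernel_coef.
apply: (@sum_prod_le _ _ _ F) => [i w|i B]; first by rewrite mulr_ge0.
rewrite -lee_fin fineK; first by rewrite -sumEFin fset_le_esum.
rewrite ge0_fin_numE; last by apply: esum_ge0 => w _; rewrite lee_fin mulr_ge0.
exact: (@bcoef_sum_finite _ _ _ _ (@a_ge0 i) (x_ge0 i) (x_nil i) (x_cat i) (m i) (m0 i) (zD i)).
Qed.

Section InDomain.
Variable z : forall i, 'rV[R[i]]_(n i).
Hypothesis zS : kernel_coef z \in sqsummable.

Lemma kernelE beta : berezin_kernel z beta = kernel_coef z beta.
Proof. by rewrite mkl2E. Qed.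

Lemma kernel_neq0 : berezin_kernel z != 0.
Proof.
apply/eqP => /(congr1 (fun h : fock R n => h (empty_word (n := n)))).
rewrite kernelE kernel_coef_empty => /eqP; apply/negP.
exact: (oner_neq0 R[i]).
Qed.

Lemma Wadj_kernel i (j : 'I_(n i)) :
  Wadj j (berezin_kernel z) = (z i 0 j)^* *: berezin_kernel z.
Proof.
apply: l2P => beta; rewrite WadjE// kernelE kernel_coef_push.
by rewrite -kernelE.
Qed.

(** The net in the definition of [Gamma] is the expansion of the kernel in the
orthonormal basis. *)
Lemma GammaE : Gamma a m z = (Num.sqrt (Delta a m z))%:C *: berezin_kernel z.
Proof.
rewrite /Gamma; congr (_ *: _).
apply: cvg_lim; first exact: norm_hausdorff.
have := @onbasis_expansion _ _ (berezin_kernel z).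
by rewrite (_ : (fun beta => berezin_kernel z beta *: onbasis beta) =
  fun beta => kernel_coef z beta *: onbasis beta)//;
  apply/funext => beta; rewrite kernelE.
Qed.

End InDomain.

(** The eigenvector equations are a recursion on the coordinates of [h], which
determines [h] from its coordinate at the empty multiword. *)
Lemma eigenvector_coef z h :
  (forall i (j : 'I_(n i)), Wadj j h = (z i 0 j)^* *: h) ->
  forall beta, h beta = h (empty_word (n := n)) * kernel_coef z beta.
Proof.
move=> hz; apply: multiword_ind => [|i j beta IH].
  by rewrite kernel_coef_empty mulr1.
have w0 : (shift_weight a m j (beta i))%:C != 0 :> R[i].
  by rewrite (fmorph_eq0 (real_complex R)) lt0r_neq0// shift_weight_gt0.
apply: (mulfI w0); rewrite mulrCA kernel_coef_push mulrCA -IH.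
by rewrite -WadjE// hz.
Qed.

End Kernel.

(** * Fourier series in the Hardy algebra *)

Section Concatenation.
Context {k : nat} {n : 'I_k -> nat}.
Implicit Types (beta gamma : multiword n).

Definition mcat beta gamma : multiword n := finfun (fun i => beta i ++ gamma i).

Lemma mcatE beta gamma i : mcat beta gamma i = beta i ++ gamma i.
Proof. by rewrite ffunE. Qed.

Lemma mcat_push i (j : 'I_(n i)) beta gamma :
  push j (mcat beta gamma) = mcat (push j beta) gamma.
Proof.
apply: multiwordP => i'; rewrite mcatE /push.
have [->|ii'] := eqVneq i' i; first by rewrite !replace_in mcatE.
by rewrite !replace_out// mcatE.
Qed.

Lemma mcat_empty_l beta : mcat (empty_word (n := n)) beta = beta.
Proof. by apply: multiwordP => i; rewrite mcatE empty_wordE. Qed.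

Lemma mcat_empty_r beta : mcat beta (empty_word (n := n)) = beta.
Proof. by apply: multiwordP => i; rewrite mcatE empty_wordE cats0. Qed.

Lemma mcat_injl gamma : injective (mcat^~ gamma).
Proof.
move=> beta beta' bb; apply: multiwordP => i.
have := congr1 (fun g : multiword n => g i) bb; rewrite !mcatE => /eqP.
have := congr1 (fun g : multiword n => size (g i)) bb; rewrite !mcatE !size_cat.
by move=> /addIn ss; rewrite eqseq_cat// eqxx andbT => /eqP.
Qed.

End Concatenation.

Section HardyAlgebra.
Context {R : realType} {k : nat} {n : 'I_k -> nat}.
Variables (a : forall i : 'I_k, seq 'I_(n i) -> R) (m : 'I_k -> nat).
Hypothesis a_ge0 : forall i (w : seq 'I_(n i)), 0 <= a w.
Hypothesis a_gt0 : forall i (j : 'I_(n i)), 0 < a [:: j].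
Implicit Types (i : 'I_k) (alpha beta gamma : multiword n) (h x : fock R n).
Implicit Types (z : forall i, 'rV[R[i]]_(n i)) (T P g : fock R n -> fock R n).

Local Notation W j := (Wop a m j).
Local Notation D beta := (root_weight a m beta).
Local Notation e0 := (@empty_word k n).

Let D_gt0 beta : 0 < D beta := root_weight_gt0 m a_ge0 a_gt0 beta.
Let DC_neq0 beta : (D beta)%:C != 0 :> R[i].
Proof. by rewrite (fmorph_eq0 (real_complex R)) lt0r_neq0. Qed.

Lemma root_weight_empty : D e0 = 1.
Proof. by rewrite /root_weight big1// => i _; rewrite empty_wordE sqrtr1. Qed.

(** Dividing the basis vectors by [D] turns the weighted shifts into unweighted
ones; the weights of a composition then telescope. *)
Definition shifts T alpha gamma :=
  T (onbasis alpha) = (D alpha / D gamma)%:C *: onbasis gamma.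

Lemma shifts_id alpha : shifts idfun alpha alpha.
Proof. by rewrite /shifts divff ?scale1r// lt0r_neq0. Qed.

Lemma shifts_comp S T alpha beta gamma : linear S ->
  shifts T alpha beta -> shifts S beta gamma -> shifts (S \o T) alpha gamma.
Proof.
rewrite /shifts /= => Sl -> ; rewrite linearZP// => ->.
rewrite scalerA -(rmorphM (real_complex R)) mulrA divfK//.
by rewrite lt0r_neq0.
Qed.

Lemma Wop_shifts i (j : 'I_(n i)) beta : shifts (W j) beta (push j beta).
Proof.
apply: l2P => gamma; rewrite Wop_val//.
transitivity ((D beta / D (push j beta))%:C * onbasis (push j beta) gamma); last by [].
have [[beta' ->]|gj] := pselect (exists beta', gamma = push j beta').
  rewrite weighted_shift_push !onbasisE (inj_eq (@push_inj _ _ _ j)).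
  have [->|_] := eqVneq beta' beta; last by rewrite !mulr0.
  by rewrite root_weight_push.
rewrite weighted_shift_off; last by move=> beta' E; apply: gj; exists beta'.
rewrite onbasisE; case: eqVneq => [E|_]; last by rewrite mulr0.
by case: gj; exists beta.
Qed.

Lemma Wop_foldr_linear (I : Type) (F : I -> fock R n -> fock R n) (s : seq I) :
  (forall t, linear (F t)) -> linear (foldr (fun t S => F t \o S) idfun s).
Proof.
by move=> Fl; elim: s => //= t s IHs c x y /=; rewrite IHs Fl.
Qed.

Local Notation monomial t := 
  (foldr (fun (ij : {i : 'I_k & 'I_(n i)}) S => Wop a m (tagged ij) \o S) idfun t).

Lemma monomial_shifts (t : seq {i : 'I_k & 'I_(n i)}) :
  exists gamma, forall alpha, shifts (monomial t) alpha (mcat gamma alpha).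
Proof.
elim: t => [|[i j] t [gamma IH]] /=.
  by exists e0 => alpha; rewrite mcat_empty_l; exact: shifts_id.
exists (push j gamma) => alpha; rewrite -mcat_push.
apply: shifts_comp (IH alpha) (Wop_shifts j _).
exact: Wop_linear.
Qed.

Lemma Wword_shifts i (w : seq 'I_(n i)) alpha :
  shifts (Wword a m w) alpha (replace alpha (w ++ alpha i)).
Proof.
elim: w => [|j w IHw] /=; first by rewrite replace_id; exact: shifts_id.
apply: shifts_comp IHw _; first exact: Wop_linear.
have := Wop_shifts j (replace alpha (w ++ alpha i)).
by rewrite /push replace_in replace_replace.
Qed.

Lemma Wword_linear i (w : seq 'I_(n i)) : linear (Wword a m w).
Proof. by apply: Wop_foldr_linear => j; exact: Wop_linear. Qed.

Lemma Wmultiword_shifts beta alpha :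
  shifts (Wmultiword a m beta) alpha (mcat beta alpha).
Proof.
pose part (s : seq 'I_k) : multiword n :=
  finfun (fun i => if i \in s then beta i ++ alpha i else alpha i).
have -> : mcat beta alpha = part (enum 'I_k).
  by apply: multiwordP => i; rewrite mcatE ffunE mem_enum.
rewrite /Wmultiword; elim: (enum 'I_k) (enum_uniq 'I_k) => [_|i s IHs] /=.
  have -> : part [::] = alpha by apply: multiwordP => i; rewrite ffunE.
  exact: shifts_id.
move=> /andP[is_ us].
have -> : part (i :: s) = replace (part s) (beta i ++ part s i).
  apply: multiwordP => i'; rewrite ffunE inE.
  have [->|ii'] := eqVneq i' i; first by rewrite replace_in ffunE (negPf is_).
  by rewrite replace_out//= ffunE.
apply: shifts_comp (IHs us) (Wword_shifts _ _).
exact: Wword_linear.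
Qed.

(** An operator commuting with right translation of multiwords, up to the
weights: its matrix is determined by its value at the vacuum vector. *)
Definition left_translation_symbol T :=
  (forall alpha beta, T (onbasis alpha) (mcat beta alpha) * (D (mcat beta alpha))%:C =
     (D alpha * D beta)%:C * T (onbasis e0) beta) /\
  (forall alpha delta, (forall beta, delta <> mcat beta alpha) ->
     T (onbasis alpha) delta = 0).

Lemma monomial_symbol t : left_translation_symbol (monomial t).
Proof.
have [gamma tg] := monomial_shifts t.
have tE alpha delta : monomial t (onbasis alpha) delta =
    (D alpha / D (mcat gamma alpha))%:C * (delta == mcat gamma alpha)%:R.
  by rewrite tg; rewrite -onbasisE.
split=> [alpha beta|alpha delta dg]; rewrite !tE; last first.
  by case: eqVneq (dg gamma) => // _ _; rewrite mulr0.
rewrite mcat_empty_r (inj_eq (@mcat_injl _ _ alpha)).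
case: eqVneq => [->|_]; last by rewrite !mulr0 mul0r.
rewrite !mulr1 root_weight_empty -!(rmorphM (real_complex R)); congr _%:C.
by rewrite divfK ?lt0r_neq0// mul1r mulfK// lt0r_neq0.
Qed.

Lemma polynomial_symbol P : W_polynomial a m P -> left_translation_symbol P.
Proof.
move=> [s ->].
have sE x delta : (\sum_(t <- s) t.1 *: monomial t.2 x) delta =
    \sum_(t <- s) t.1 * monomial t.2 x delta by rewrite l2_sum.
split=> [alpha beta|alpha delta dg]; rewrite !sE.
  rewrite mulr_suml mulr_sumr; apply: eq_bigr => t _.
  by rewrite -mulrA (monomial_symbol t.2).1 mulrCA.
by rewrite big1// => t _; rewrite (monomial_symbol t.2).2 ?mulr0.
Qed.

Lemma cvgC_unique (u : nat -> R[i]) (l l' : R[i]) :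
  u @ \oo --> l -> u @ \oo --> l' -> l = l'.
Proof. by apply: cvg_unique; exact: norm_hausdorff. Qed.

(** Both conditions are closed under coordinatewise limits. *)
Lemma hardy_symbol g : hardy_algebra a m g -> left_translation_symbol g.
Proof.
move=> [_ [P [Ppol Pg]]].
have Pc x delta : (fun N => P N x delta) @ \oo --> g x delta.
  exact: coord_cvg (Pg x).
split=> [alpha beta|alpha delta dg].
  apply: (@cvgC_unique (fun N => (D (mcat beta alpha))%:C *
      P N (onbasis alpha) (mcat beta alpha))); first by rewrite mulrC; exact: cvgCZ.
  rewrite (_ : (fun N => _) = fun N => (D alpha * D beta)%:C * P N (onbasis e0) beta).
    exact: cvgCZ.
  by apply/funext => N; rewrite mulrC (polynomial_symbol (Ppol N)).1.
apply: (cvgC_unique (Pc _ _)).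
rewrite (_ : (fun N => _) = fun=> 0); first exact: cvg_cst.
by apply/funext => N; rewrite (polynomial_symbol (Ppol N)).2.
Qed.

(** On the basis vector at [alpha] the series is the basis expansion of its image,
re-indexed along the injective translation by [alpha]: off the range of that
translation the image has no coordinates. *)
Lemma hardy_fourier g : hardy_algebra a m g ->
  fourier_representation a m g (fun beta => (D beta)%:C * g (onbasis e0) beta).
Proof.
move=> /hardy_symbol[gE g0] alpha.
have := sum_reindex (@mcat_injl k n alpha) _
  (@onbasis_expansion _ _ (g (onbasis alpha))).
rewrite (_ : _ \o _ = fun beta =>
    ((D beta)%:C * g (onbasis e0) beta) *: Wmultiword a m beta (onbasis alpha)).
  by apply => delta dg; rewrite g0// scale0r.
apply/funext => beta /=; rewrite Wmultiword_shifts scalerA; congr (_ *: _).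
apply: (mulIf (DC_neq0 (mcat beta alpha))); rewrite gE -[RHS]mulrA.
rewrite -[in RHS](rmorphM (real_complex R)) divfK ?lt0r_neq0//.
by rewrite [in LHS](rmorphM (real_complex R)) -mulrA mulrC.
Qed.

(** At the vacuum vector the terms are multiples of distinct basis vectors, so a
coordinate of the limit isolates one coefficient. *)
Lemma fourier_unique g c : fourier_representation a m g c ->
  forall beta, c beta = (D beta)%:C * g (onbasis e0) beta.
Proof.
move=> /(_ e0) gc beta.
have WE gamma : (c gamma *: Wmultiword a m gamma (onbasis e0)) beta =
    c gamma * (D gamma)^-1%:C * (beta == gamma)%:R.
  rewrite Wmultiword_shifts mcat_empty_r root_weight_empty div1r scalerA.
  by rewrite -onbasisE.
pose f gamma : R[i] := c gamma * (D gamma)^-1%:C * (beta == gamma)%:R.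
have f1 : partial_sum f @ totally --> f beta.
  by apply: sum_single => gamma; rewrite eq_sym /f => /negPf ->; rewrite mulr0.
have f2 : partial_sum f @ totally --> g (onbasis e0) beta.
  have -> : partial_sum f = fun A => (partial_sum
      (fun gamma => c gamma *: Wmultiword a m gamma (onbasis e0)) A : fock R n) beta.
    apply/funext => A; rewrite [LHS]partial_sumE [in RHS]partial_sumE l2_sum.
    by apply: eq_bigr => gamma _; rewrite -[LHS]WE.
  exact: coord_cvg gc.
have : f beta = g (onbasis e0) beta by apply: cvg_unique f1 f2; exact: norm_hausdorff.
rewrite /f eqxx mulr1 => <-; rewrite mulrCA -(rmorphM (real_complex R)).
by rewrite mulfV ?mulr1 ?rmorph1 ?mulr1// lt0r_neq0.
Qed.

(** The Fourier coefficient at [beta] times [z_beta] is the product of coordinates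
in [inner (g 1) K], because the factor [D beta] is shared. *)
Lemma eval_hardyE g z : hardy_algebra a m g -> kernel_coef a m z \in sqsummable ->
  eval_hardy a m g z = inner (g (onbasis e0)) (berezin_kernel a m z).
Proof.
move=> gH zS; rewrite /eval_hardy.
have := getPex (ex_intro _ _ (hardy_fourier gH)); set c := get _ => /fourier_unique cE.
rewrite /inner; congr (sum _); apply/funext => beta.
rewrite cE kernelE// kernel_coef_conj conjM conjCK conjR.
by rewrite [LHS]mulrC [RHS]mulrC mulrA.
Qed.

(** Since the kernel is a joint eigenvector of the adjoints, polynomials act on
it as scalars; this passes to limits. *)
Lemma inner_hardy_kernel g z x : hardy_algebra a m g ->
  kernel_coef a m z \in sqsummable ->
  inner (g x) (berezin_kernel a m z) =
  inner (g (onbasis e0)) (berezin_kernel a m z) * inner x (berezin_kernel a m z).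
Proof.
move=> [_ [P [Ppol Pg]]] zS; set K := berezin_kernel a m z.
have K0 : inner (onbasis e0) K = 1.
  by rewrite innerC inner_onbasis kernelE// kernel_coef_empty conj1.
have mono t : exists p : R[i], forall y, inner (monomial t y) K = p * inner y K.
  elim: t => [|[i j] t [p IH]] /=; first by exists 1 => y; rewrite mul1r.
  exists (z i 0 j * p) => y.
  by rewrite inner_Wadj// Wadj_kernel// innerZr conjCK IH mulrA.
have poly N y : inner (P N y) K = inner (P N (onbasis e0)) K * inner y K.
  have [s PE] := Ppol N.
  have [p pE] : exists p : R[i], forall y, inner (P N y) K = p * inner y K.
    rewrite PE; elim: s {PE} => [|t s [p IH]].
      by exists 0 => y'; rewrite big_nil inner0l mul0r.
    have [q qE] := mono t.2; exists (t.1 * q + p) => y'.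
    by rewrite big_cons innerDl innerZl qE IH mulrDl mulrA.
  by rewrite !pE K0 mulr1.
apply: (@cvgC_unique (fun N => inner (P N x) K)); first exact: inner_cvgl.
under eq_cvg do rewrite poly mulrC.
by rewrite mulrC; apply: cvgCZ; exact: inner_cvgl.
Qed.

End HardyAlgebra.

(** * The variety and its universal model *)

Section Variety.
Context {R : realType} {k : nat} {n : 'I_k -> nat}.
Variables (a : forall i : 'I_k, seq 'I_(n i) -> R) (m : 'I_k -> nat).
Variable J : set (fock R n -> fock R n).
Hypothesis a_ge0 : forall i (w : seq 'I_(n i)), 0 <= a w.
Hypothesis a_gt0 : forall i (j : 'I_(n i)), 0 < a [:: j].
Hypothesis Jideal : wot_closed_left_ideal a m J.
Implicit Types (i : 'I_k) (h x : fock R n).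
Implicit Types (z : forall i, 'rV[R[i]]_(n i)) (g : fock R n -> fock R n).

Local Notation e0 := (@empty_word k n).

(** Vanishing on the ranges passes to their span and to its closure by continuity
of the inner product. *)
Lemma NJP h : NJ J h <-> forall g, J g -> forall x, inner (g x) h = 0.
Proof.
split=> [hN g Jg x|hJ v vM].
  rewrite innerC (hN (g x)) ?conj0//; apply: subset_closure.
  by exists 1%N, (fun=> g), (fun=> x); rewrite big_ord1.
apply/eq0_normc/eqP; rewrite eq_le normc_ge0 andbT; apply/ler_addgt0Pr => e e_gt0.
rewrite add0r.
have /(@cvgCP _ _ (nbhs v) (nbhs_filter v))/(_ e e_gt0) :=
  @inner_cvgl _ _ _ (nbhs v) (nbhs_filter v) id v h (@cvg_id _ (nbhs v)).
move=> /vM[w [[N [g [x [Jg ->]]]]]]; rewrite inner_suml big1 ?subr0; last first.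
  by move=> l _; exact: hJ.
by rewrite innerC normcJ_eq => /ltW.
Qed.

Lemma NJ0 : NJ J 0.
Proof. by apply/NJP => g _ x; rewrite inner0r. Qed.

Lemma NJ_lin (c : R[i]) h h' : NJ J h -> NJ J h' -> NJ J (c *: h + h').
Proof.
move=> /NJP hN /NJP hN'; apply/NJP => g Jg x.
by rewrite innerDr innerZr hN// hN'// mulr0 addr0.
Qed.

Lemma NJ_scale (c : R[i]) h : NJ J h -> NJ J (c *: h).
Proof. by move=> hN; rewrite -[_ *: _]addr0; exact: NJ_lin hN NJ0. Qed.

Lemma NJ_closed (u : nat -> fock R n) h :
  (forall N, NJ J (u N)) -> u @ \oo --> h -> NJ J h.
Proof.
move=> uN uh; apply/NJP => g Jg x; rewrite innerC.
have c : (fun N => inner (u N) (g x)) @ \oo --> inner h (g x).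
  exact: inner_cvgl uh.
have c0 : (fun N => inner (u N) (g x)) = fun=> 0.
  by apply/funext => N; rewrite innerC ((NJP (u N)).1 (uN N))// conj0.
rewrite c0 in c; have -> : inner h (g x) = 0; last exact: conj0.
by apply: (cvgC_unique c); exact: cvg_cst.
Qed.

Lemma Wop_hardy i (j : 'I_(n i)) : hardy_algebra a m (Wop a m j).
Proof.
split; first exact: Wop_bounded.
exists (fun=> Wop a m j); split=> [_|x]; last exact: cvg_cst.
exists [:: (1, [:: Tagged (fun i => 'I_(n i)) j])].
by apply/funext => x; rewrite big_seq1 /= scale1r.
Qed.

(** Testing against [g x] amounts to testing [h] against the image of [x] under the
composition of the shift with [g], an element of the left ideal [J]. *)
Lemma NJ_Wadj i (j : 'I_(n i)) h : NJ J h -> NJ J (Wadj a m j h).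
Proof.
move=> /NJP hN; apply/NJP => g Jg x; rewrite -inner_Wadj//.
case: Jideal => _ _ _ /(_ _ _ (Wop_hardy j) Jg) JWg _.
exact: hN JWg x.
Qed.

(** The adjoint shift preserves [NJ J] and has the property that defines the
adjoint of the compression, a property that has at most one solution in
[NJ J]. *)
Lemma SadjE i (j : 'I_(n i)) h : NJ J h -> Sadj a m J j h = Wadj a m j h.
Proof.
move=> hN.
have adj x : inner (Sop a m J j x) h = inner x (Wadj a m j h).
  have [_ /(_ h hN) /eqP] := orthoprojP NJ0 NJ_lin NJ_closed (Wop a m j x).
  by rewrite innerBl subr_eq0 inner_Wadj// => /eqP ->.
have [vN vE] : [set v | NJ J v /\
    forall x, NJ J x -> inner (Sop a m J j x) h = inner x v] (Sadj a m J j h).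
  by apply: getPex; exists (Wadj a m j h); split=> [|x _]; [exact: NJ_Wadj|exact: adj].
set v := Sadj a m J j h in vN vE *; apply/eqP; rewrite -subr_eq0; apply/eqP.
set d := v - _.
have dN : NJ J d.
  by rewrite /d addrC -scaleN1r; apply: NJ_lin vN; exact: NJ_Wadj.
have : inner d d = 0 by rewrite {2}/d innerBr -vE// adj subrr.
rewrite inner_xx => /complexI/eqP; rewrite expf_eq0/= => /eqP d0.
by apply/val_inj; exact: (l2norm_eq0 (valP d) d0).
Qed.

(** Pairing any range vector [g x] with the kernel gives [g(z)] times the pairing of
[x], and [x] may be the vacuum vector. *)
Lemma NJ_kernel z : kernel_coef a m z \in sqsummable ->
  NJ J (berezin_kernel a m z) <-> forall g, J g -> eval_hardy a m g z = 0.
Proof.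
have JH : J `<=` hardy_algebra a m by case: Jideal.
move=> zS; split=> [/NJP KN g Jg|zJ].
  by rewrite eval_hardyE ?KN//; exact: JH.
apply/NJP => g Jg x; rewrite inner_hardy_kernel//; last exact: JH.
by rewrite -eval_hardyE// ?zJ ?mul0r//; exact: JH.
Qed.

Lemma Delta_gt0 z : scalar_polydomain a z -> 0 < Delta a m z.
Proof.
move=> zD; apply: prodr_gt0 => i _; rewrite exprn_gt0// subr_gt0 -lte_fin fineK//.
rewrite ge0_fin_numE ?(lt_trans (zD i)) ?ltry//.
by apply: esum_ge0 => w _; rewrite lee_fin mulr_ge0 ?sqr_ge0.
Qed.

Hypothesis m_gt0 : forall i, (0 < m i)%N.

Lemma variety_kernel z : scalar_variety a m J z ->
  kernel_coef a m z \in sqsummable /\ NJ J (berezin_kernel a m z).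
Proof.
move=> [zD zJ]; have zS : kernel_coef a m z \in sqsummable.
  exact/kernel_sqsummableP.
by split=> //; apply/NJ_kernel.
Qed.

Lemma Sadj_Gamma z i (j : 'I_(n i)) : scalar_variety a m J z ->
  Sadj a m J j (Gamma a m z) = (z i 0 j)^* *: Gamma a m z.
Proof.
move=> /variety_kernel[zS zN]; rewrite GammaE//.
rewrite SadjE; last exact: NJ_scale.
apply: l2P => beta; rewrite WadjE//.
have := congr1 (fun h : fock R n => h beta) (Wadj_kernel a_ge0 a_gt0 zS j).
rewrite WadjE// => E.
transitivity ((Num.sqrt (Delta a m z))%:C * ((z i 0 j)^* * berezin_kernel a m z beta)).
  by rewrite -[(z i 0 j)^* * _]E mulrCA.
by rewrite mulrCA.
Qed.

Lemma joint_eigenvectorP h : joint_eigenvector a m J h <->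
  exists z (c : R[i]),
    [/\ scalar_variety a m J z, c != 0 & h = c *: Gamma a m z].
Proof.
split=> [[hN h0 hS]|[z [c [zV c0 ->]]]]; last first.
  have [zS zN] := variety_kernel zV.
  have s0 : (Num.sqrt (Delta a m z))%:C != 0 :> R[i].
    rewrite (fmorph_eq0 (real_complex R)) lt0r_neq0// sqrtr_gt0.
    by apply: Delta_gt0; case: zV.
  have GN : NJ J (Gamma a m z) by rewrite GammaE//; exact: NJ_scale.
  split; first exact: NJ_scale.
    by rewrite GammaE// !scaler_eq0 (negPf c0) (negPf s0) kernel_neq0.
  move=> i j; exists (z i 0 j)^*; rewrite SadjE; last exact: NJ_scale.
  apply: l2P => beta; rewrite WadjE//.
  have := Sadj_Gamma j zV; rewrite SadjE// => E.
  have := congr1 (fun h : fock R n => h beta) E; rewrite WadjE// => {}E.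
  transitivity (c * ((z i 0 j)^* * Gamma a m z beta)).
    by rewrite -[(z i 0 j)^* * _]E mulrCA.
  by rewrite mulrCA.
pose mu i (j : 'I_(n i)) := projT1 (cid (hS i j)).
have muE i (j : 'I_(n i)) : Wadj a m j h = mu i j *: h.
  by rewrite -SadjE// /mu; case: cid.
pose z i : 'rV[R[i]]_(n i) := \row_j (mu i j)^*.
have hz i (j : 'I_(n i)) : Wadj a m j h = (z i 0 j)^* *: h.
  by rewrite mxE conjCK muE.
have hE := eigenvector_coef a_ge0 a_gt0 hz.
have he0 : h e0 != 0.
  apply: contra h0 => /eqP he0; apply/eqP/l2P => beta.
  by rewrite hE he0 mul0r.
have zS : kernel_coef a m z \in sqsummable.
  rewrite (_ : kernel_coef a m z = (h e0)^-1 *: (h : multiword n -> R[i])).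
    by rewrite rpredZ//; exact: valP.
  apply/funext => beta; transitivity ((h e0)^-1 * h beta); last by [].
  by rewrite [h beta]hE mulKf.
have zD : scalar_polydomain a z by apply/(@kernel_sqsummableP _ _ _ _ m).
have hK : h = h e0 *: berezin_kernel a m z.
  by apply: l2P => beta; rewrite [LHS]hE -kernelE.
have KN : NJ J (berezin_kernel a m z).
  have -> : berezin_kernel a m z = (h e0)^-1 *: h.
    by rewrite {2}hK scalerA mulVf// scale1r.
  exact: NJ_scale.
have s0 : (Num.sqrt (Delta a m z))%:C != 0 :> R[i].
  by rewrite (fmorph_eq0 (real_complex R)) lt0r_neq0// sqrtr_gt0 Delta_gt0.
(* [Gamma] has coordinate [sqrt Delta] at the empty multiword. *)
exists z, (h e0 / (Num.sqrt (Delta a m z))%:C); split.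
- by split=> //; apply/NJ_kernel.
- by rewrite mulf_neq0// invr_eq0.
- by rewrite GammaE// scalerA divfK.
Qed.

End Variety.

Local Open Scope complex_scope.

Theorem theorem3p1 (R : realType) (k : nat) (n m : 'I_k -> nat)
    (a : forall i : 'I_k, seq 'I_(n i) -> R)
    (J : set (fock R n -> fock R n)) :
  (0 < k)%N ->
  (forall i, 0 < n i)%N ->
  (forall i, 0 < m i)%N ->
  (forall i, positive_regular (a i)) ->
  wot_closed_left_ideal a m J ->
  (exists2 h, NJ J h & h != 0) ->
  (forall h : fock R n,
     joint_eigenvector a m J h <->
     exists (lambda : forall i, 'rV[R[i]]_(n i)) (c : R[i]),
       [/\ scalar_variety a m J lambda, c != 0 & h = c *: Gamma a m lambda])
  /\
  (forall lambda : forall i, 'rV[R[i]]_(n i),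
     scalar_variety a m J lambda ->
     forall (i : 'I_k) (j : 'I_(n i)),
       Sadj a m J j (Gamma a m lambda) =
         (lambda i 0 j)^* *: Gamma a m lambda).
Proof.
move=> _ _ m_gt0 areg Jideal _.
have a_ge0 i w : 0 <= a i w by case: (areg i).
have a_gt0 i j : 0 < a i [:: j] by case: (areg i).
split=> [h|lambda lV i j]; first exact: joint_eigenvectorP.
exact: Sadj_Gamma.
Qed.
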